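(* Let $\mathbf{d}=(d_1,d_2,n-1,\dots,n-1,n,\dots,n)$ be a Dyck path on an $n\times n$ board (i.e. $d_i\in\{n-1,n\}$ for all $i\ge 3$, with the entries equal to $n-1$ preceding those equal to $n$) with bounce number $|\mathbf{m}|=3$, let $P=P(\mathbf{d})$ and $G=\mathrm{inc}(P)$. Then $X_G(\mathbf{x},q)$ is $e$-positive, i.e. every coefficient in its expansion in the elementary symmetric function basis lies in $\mathbb{N}[q]$.
   Context: A Dyck path on an $n\times n$ board is a sequence $\mathbf{d}=(d_1,\dots,d_{n-1})$ of positive integers with $d_1\le\cdots\le d_{n-1}\le n$ and $d_i\ge i$. The poset $P(\mathbf{d})$ on $[n]$ has relations $i\prec j$ iff $i<n$ and $d_i<j\le n$ (a natural unit interval order). The bounce sequence $\mathbf{m}=(m_0,\dots,m_l)$ is given by $m_0=d_1$, $m_i=d_{m_{i-1}+1}$, stopping at $m_l=n$; the bounce number is $|\mathbf{m}|=l+1$. The incomparability graph $\mathrm{inc}(P)$ has vertex set $[n]$ with an edge between two elements iff they are incomparable in $P$. For a graph $G$ on $[n]$, $X_G(\mathbf{x},q)=\sum_{\kappa}q^{\mathrm{asc}(\kappa)}\prod_{v}x_{\kappa(v)}$, summed over proper colorings $\kappa:[n]\to\{1,2,\dots\}$, where $\mathrm{asc}(\kappa)$ is the number of edges $\{i,j\}$ with $i<j$ and $\kappa(i)<\kappa(j)$; for $G=\mathrm{inc}(P(\mathbf{d}))$ it is a symmetric function with coefficients in $\mathbb{Z}[q]$. *)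

(* Defs.v *)
From mathcomp Require Import all_boot all_order all_algebra.
From mathcomp.multinomials Require Export mpoly.

Set Implicit Arguments.
Unset Strict Implicit.
Unset Printing Implicit Defensive.

Import GRing.Theory Num.Theory.
Local Open Scope ring_scope.

(* A Dyck path d = (d_1, ..., d_(n-1)) is stored as a 0-indexed sequence;
   dyck_entry n d i is d_i, for i >= 1.  The default value n gives the usual
   convention d_n = n, which the bounce sequence uses when m_(i-1) = n - 1. *)
Definition dyck_entry (n : nat) (d : seq nat) (i : nat) : nat := nth n d i.-1.

Definition is_dyck_path (n : nat) (d : seq nat) : Prop :=
  [/\ size d = n.-1,
      sorted leq d,
      all (fun k => 0 < k <= n)%N d
    & forall i, (0 < i < n)%N -> (i <= dyck_entry n d i)%N].

(* The ordinal i : 'I_n stands for the element i.+1 of [n] = {1, ..., n}. *)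
Definition dyck_prec (n : nat) (d : seq nat) : rel 'I_n :=
  [rel i j : 'I_n | (i.+1 < n)%N && (dyck_entry n d i.+1 < j.+1 <= n)%N].

(* The sequence m_0 = d_1, m_i = d_(m_(i-1) + 1), cut after the first value n.
   On a Dyck path it increases strictly until it reaches n, so that its first
   n terms contain n. *)
Definition bounce_seq (n : nat) (d : seq nat) : seq nat :=
  let m := traject (fun k => dyck_entry n d k.+1) (dyck_entry n d 1) n in
  take (index n m).+1 m.

Definition bounce_number (n : nat) (d : seq nat) : nat := size (bounce_seq n d).

Definition inc (T : finType) (prec : rel T) : rel T :=
  [rel x y | [&& x != y, ~~ prec x y & ~~ prec y x]].

Section Chromatic.

Variables (n : nat) (G : rel 'I_n).

Definition proper_coloring (N : nat) (kappa : {ffun 'I_n -> 'I_N}) : bool :=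
  [forall u, forall v, G u v ==> (kappa u != kappa v)].

Definition asc (N : nat) (kappa : {ffun 'I_n -> 'I_N}) : nat :=
  #|[set p : 'I_n * 'I_n | [&& G p.1 p.2, (p.1 < p.2)%N
                             & (kappa p.1 < kappa p.2)%N]]|.

(* X_G(x_1, ..., x_N, 0, 0, ...; q), where q is the indeterminate of
   {poly int}: only the colorings with colors in {1, ..., N} survive. *)
Definition chromatic_qsym (N : nat) : {mpoly {poly int}[N]} :=
  \sum_(kappa : {ffun 'I_n -> 'I_N} | proper_coloring kappa)
     ('X : {poly int}) ^+ asc kappa *: \prod_(v < n) 'X_(kappa v).

End Chromatic.

(* A symmetric function f over Z[q], in x_1, x_2, ..., is represented by the
   family of its restrictions F N = f(x_1, ..., x_N, 0, 0, ...), as in the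
   construction of the ring of symmetric functions as an inverse limit.  An
   identity between symmetric functions is an identity for all N. *)
Definition symfun := forall N : nat, {mpoly {poly int}[N]}.

Definition is_partition (la : seq nat) : bool :=
  sorted geq la && all (leq 1) la.

Definition esym (la : seq nat) : symfun :=
  fun N => \prod_(k <- la) mesym N {poly int} k.

(* f = \sum_(la in S) c la *: e_la, for a finite set S of partitions; S and c
   must not depend on the number of variables. *)
Definition e_expansion (F : symfun) (S : seq (seq nat))
    (c : seq nat -> {poly int}) : Prop :=
  [/\ uniq S, all is_partition S
    & forall N, F N = \sum_(la <- S) c la *: esym la N].

(* As the e_la form a basis, the expansion is unique up to zero terms. *)
Definition e_positive (F : symfun) : Prop :=
  exists S c, e_expansion F S c /\
    forall la, la \in S -> c la \is a polyOver Num.nneg.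

(* Main.v *)
Require Import Defs.
From mathcomp Require Import all_boot all_order all_algebra.
From mathcomp Require Import all_fingroup zify ring.

(* If [j] and [j + 1] are adjacent and have the same neighbours except for one
   vertex [u], which is joined to none, one or both of them in three graphs, the
   three chromatic functions satisfy the modular law
   [(1 + q) X_1 = q X_0 + X_2].  Hence, when [u] is joined to the first (or last)
   [k] vertices of a clique, [X] is an affine function of [qnum q k].

   With [d_1 > 1] the graph is a clique of size [m = n - 3], two adjacent vertices
   on its left joined to its first [p <= r] vertices, and one vertex on its right
   joined to its last [b] vertices, where [p + b < m].  By the modular law [X] is,
   on the region [r + b <= m], a combination of six unknowns, and on
   [r + b >= m] it is interpolated from the boundary of that region and from
   [r = m].  The unknowns are read off from disjoint unions of cliques, after
   exchanging the roles of the last vertex and of its predecessors when [b] is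
   close to [m].  With [d_1 = 1] the first vertex is isolated and the rest is a
   clique with one vertex at either end.  In all cases the resulting coefficients
   can be rearranged into sums of products of [q]-numbers. *)

Set Implicit Arguments.
Unset Strict Implicit.
Unset Printing Implicit Defensive.

Import GRing.Theory Num.Theory.
Local Open Scope ring_scope.

(** * Colorings as products of local weights *)

Definition join_ffun (T : Type) s t (k1 : {ffun 'I_s -> T})
    (k2 : {ffun 'I_t -> T}) : {ffun 'I_(s + t) -> T} :=
  [ffun i => match split i with inl a => k1 a | inr b => k2 b end].

Lemma join_ffunl (T : Type) s t (k1 : {ffun 'I_s -> T})
    (k2 : {ffun 'I_t -> T}) i : join_ffun k1 k2 (lshift t i) = k1 i.
Proof. by rewrite ffunE (unsplitK (inl i)). Qed.

Lemma join_ffunr (T : Type) s t (k1 : {ffun 'I_s -> T})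
    (k2 : {ffun 'I_t -> T}) i : join_ffun k1 k2 (rshift s i) = k2 i.
Proof. by rewrite ffunE (unsplitK (inr i)). Qed.

Lemma sum_join_ffun (A : nmodType) (T : finType) s t
    (F : {ffun 'I_(s + t) -> T} -> A) :
  \sum_k F k = \sum_k1 \sum_k2 F (join_ffun k1 k2).
Proof.
rewrite pair_big /= (reindex (fun p => join_ffun p.1 p.2)) //=.
exists (fun k => ([ffun i => k (lshift t i)], [ffun i => k (rshift s i)])).
  move=> [k1 k2] _; congr pair; apply/ffunP => i; rewrite ffunE /=.
    by rewrite join_ffunl.
  by rewrite join_ffunr.
move=> k _; apply/ffunP => i; rewrite -(splitK i).
by case: (split i) => j /=; rewrite ?join_ffunl ?join_ffunr ffunE.
Qed.

Section Coloring.
Variable N : nat.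
Local Notation R := {mpoly {poly int}[N]}.

Definition qvar : R := ('X : {poly int})%:MP.
Local Notation q := qvar.

(** A monochromatic edge has weight 0, so that sums can run over all colorings. *)
Definition edge_weight (c d : 'I_N) : R :=
  if c == d then 0 else if (c < d)%N then q else 1.

(** Graphs are relations on [nat], read on pairs [i < j] only: they can be cut and shifted without
    casts between ordinals. *)
Definition coloring_weight n (E : rel nat) (kappa : {ffun 'I_n -> 'I_N}) : R :=
  \prod_(i < n) \prod_(j < n | (i < j)%N)
     (if E i j then edge_weight (kappa i) (kappa j) else 1).

Definition csf n (E : rel nat) : R :=
  \sum_(kappa : {ffun 'I_n -> 'I_N})
     coloring_weight E kappa * \prod_(v < n) 'X_(kappa v).

Lemma csf_ext n (E E' : rel nat) :
  (forall i j, (i < j < n)%N -> E i j = E' i j) -> csf n E = csf n E'.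
Proof.
move=> eqE; apply: eq_bigr => k _; congr (_ * _).
apply: eq_bigr => i _; apply: eq_bigr => j ij.
by rewrite eqE // ij ltn_ord.
Qed.

Lemma chromatic_qsym_csf n (G : rel 'I_n) (E : rel nat) :
  irreflexive G -> symmetric G ->
  (forall i j : 'I_n, (i < j)%N -> G i j = E i j) ->
  chromatic_qsym G N = csf n E.
Proof.
move=> Girr Gsym GE; rewrite /chromatic_qsym big_mkcond /=.
apply: eq_bigr => k _; case: ifPn => [prop | improp].
  rewrite -mul_mpolyC; congr (_ * _); rewrite /coloring_weight pair_big_dep /=.
  rewrite rmorphXn /= -/q /asc -prodr_const big_mkcond [RHS]big_mkcond /=.
  apply: eq_bigr => -[i j] _; rewrite inE /=.
  case: ltnP => ij; last by rewrite andbF.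
  rewrite -GE //; case Gij: (G i j) => //=; rewrite /edge_weight.
  by move/forallP: prop => /(_ i)/forallP/(_ j); rewrite Gij => /negPf ->.
have [i [j [ij Gij kij]]] : exists i j : 'I_n, [/\ (i < j)%N, G i j & k i = k j].
  move: improp; rewrite negb_forall => /existsP[u].
  rewrite negb_forall => /existsP[v]; rewrite negb_imply negbK => /andP[Guv /eqP kuv].
  case: (ltngtP u v) => uv; first by exists u, v.
    by exists v, u; rewrite Gsym.
  by move: Guv; rewrite (val_inj uv) Girr.
rewrite /coloring_weight (bigD1 i) //= (bigD1 j) //= -GE // Gij.
by rewrite /edge_weight kij eqxx !mul0r.
Qed.

Lemma csf_split s t (E : rel nat) :
  (forall i j, (i < s <= j)%N -> E i j = false) ->
  csf (s + t) E = csf s E * csf t (fun i j => E (s + i) (s + j))%N.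
Proof.
move=> Esep; rewrite /csf sum_join_ffun big_distrl /=.
apply: eq_bigr => k1 _; rewrite big_distrr /=; apply: eq_bigr => k2 _.
rewrite big_split_ord /= mulrACA; congr (_ * (_ * _)); last first.
- by apply: eq_bigr => i _; rewrite join_ffunr.
- by apply: eq_bigr => i _; rewrite join_ffunl.
rewrite /coloring_weight big_split_ord /=; congr (_ * _).
  apply: eq_bigr => i _; rewrite big_mkcond big_split_ord /=.
  rewrite [X in _ * X]big1 ?mulr1 => [|j _].
    by rewrite [RHS]big_mkcond; apply: eq_bigr => j _; rewrite !join_ffunl.
  by rewrite Esep ?if_same // ltn_ord leq_addr.
apply: eq_bigr => i _; rewrite big_mkcond big_split_ord /=.
rewrite [X in X * _]big1 ?mul1r => [|j _].
  rewrite [RHS]big_mkcond; apply: eq_bigr => j _.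
  by rewrite ltn_add2l !join_ffunr.
by rewrite ltnNge (leq_trans (ltnW (ltn_ord j)) (leq_addr _ _)).
Qed.
End Coloring.

(** * The modular law *)

(** Here [c] is the color of the extra vertex and [a], [b] are those of the twins. Once both ways of
    giving [a] and [b] to the twins are added, the modular law holds locally; only the relative
    order of the three colors matters. *)
Lemma three_term_left (S : comNzRingType) (t : S) (c a b : nat) :
  let f x y : S := if x == y then 0 else if (x < y)%N then t else 1 in
  (1 + t) * (f c a * 1 * f a b + f c b * 1 * f b a)
  = t * (1 * 1 * f a b + 1 * 1 * f b a)
    + (f c a * f c b * f a b + f c b * f c a * f b a).
Proof.
rewrite /=.
by case: (ltngtP c a) => ?; case: (ltngtP c b) => ?; case: (ltngtP a b) => ?;
  try lia; ring.
Qed.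

Lemma three_term_right (S : comNzRingType) (t : S) (c a b : nat) :
  let f x y : S := if x == y then 0 else if (x < y)%N then t else 1 in
  (1 + t) * (1 * f b c * f a b + 1 * f a c * f b a)
  = t * (1 * 1 * f a b + 1 * 1 * f b a)
    + (f a c * f b c * f a b + f b c * f a c * f b a).
Proof.
rewrite /=.
by case: (ltngtP a c) => ?; case: (ltngtP b c) => ?; case: (ltngtP a b) => ?;
  try lia; ring.
Qed.

Section Modular.
Variables (N n : nat).
Local Notation R := {mpoly {poly int}[N]}.
Local Notation q := (qvar N).

Lemma two_neq0 : (2%:R : R) != 0.
Proof. by rewrite -mpolyC_nat mpolyC_eq0 -polyC_natr polyC_eq0. Qed.

Definition pair_weight (E : rel nat) (k : {ffun 'I_n -> 'I_N})
    (p : 'I_n * 'I_n) : R :=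
  if E p.1 p.2 then edge_weight (k p.1) (k p.2) else 1.

Lemma coloring_weight_pairs (E : rel nat) (k : {ffun 'I_n -> 'I_N}) :
  coloring_weight E k = \prod_(p : 'I_n * 'I_n | (p.1 < p.2)%N) pair_weight E k p.
Proof. by rewrite /coloring_weight pair_big_dep. Qed.

(* [x] and [y] carry the pairs that distinguish the three graphs, [z] is the
   pair of adjacent twins that the transposition [s] exchanges. *)
Lemma csf_three_term (E0 E1 E2 : rel nat) (s : {perm 'I_n})
    (x y z : 'I_n * 'I_n) :
  (s * s = 1)%g -> uniq [:: x; y; z] ->
  all (fun p : 'I_n * 'I_n => p.1 < p.2)%N [:: x; y; z] ->
  (forall p : 'I_n * 'I_n, (p.1 < p.2)%N -> p \notin [:: x; y; z] ->
     [/\ (s p.1 < s p.2)%N, (s p.1, s p.2) \notin [:: x; y; z],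
         E0 p.1 p.2 = E0 (s p.1) (s p.2), E1 p.1 p.2 = E0 p.1 p.2 &
         E2 p.1 p.2 = E0 p.1 p.2]) ->
  (forall k : {ffun 'I_n -> 'I_N}, let k' := [ffun i => k (s i)] in
     let w E k := pair_weight E k x * pair_weight E k y * pair_weight E k z in
     (1 + q) * (w E1 k + w E1 k') = q * (w E0 k + w E0 k') + (w E2 k + w E2 k')) ->
  (1 + q) * csf N n E1 = q * csf N n E0 + csf N n E2.
Proof.
move=> ss xyz_uniq /and4P[x_lt y_lt z_lt _] twin loc.
have sK : involutive s by move=> i; rewrite -permM ss perm1.
pose tw (k : {ffun 'I_n -> 'I_N}) : {ffun 'I_n -> 'I_N} := [ffun i => k (s i)].
have twK : involutive tw by move=> k; apply/ffunP => i; rewrite !ffunE sK.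
pose M (k : {ffun 'I_n -> 'I_N}) : R := \prod_(v < n) 'X_(k v).
have Mtw k : M (tw k) = M k.
  rewrite /M [RHS](reindex_inj (@perm_inj _ s)).
  by apply: eq_bigr => i _; rewrite ffunE.
pose w E k := pair_weight E k x * pair_weight E k y * pair_weight E k z.
pose P E k := \prod_(p : 'I_n * 'I_n | ((p.1 < p.2)%N && (p \notin [:: x; y; z]))) pair_weight E k p.
have PE (E : rel nat) k : (forall p : 'I_n * 'I_n, (p.1 < p.2)%N -> p \notin [:: x; y; z] ->
    E p.1 p.2 = E0 p.1 p.2) -> P E k = P E0 k.
  by move=> eqE; apply: eq_bigr => p /andP[? ?]; rewrite /pair_weight eqE.
have wtE (E : rel nat) k : coloring_weight E k = w E k * P E k.
  rewrite coloring_weight_pairs (bigD1 x) //= (bigD1 y) /=; last first.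
    by rewrite y_lt; move: xyz_uniq; rewrite /= !inE (eq_sym y x); case: (x == y).
  rewrite (bigD1 z) /=; last first.
    rewrite z_lt; move: xyz_uniq; rewrite /= !inE (eq_sym z x) (eq_sym z y).
    by case: (x == z); case: (x == y); case: (y == z).
  rewrite !mulrA; congr (_ * _); apply: eq_bigl => p.
  by rewrite !inE !negb_or -!andbA.
pose ss2 (p : 'I_n * 'I_n) := (s p.1, s p.2).
have ss2K : involutive ss2 by case=> a b; rewrite /ss2 /= !sK.
have Ptw k : P E0 (tw k) = P E0 k.
  rewrite /P [RHS](reindex_inj (inv_inj ss2K)) /=.
  have dom (p : 'I_n * 'I_n) : ((s p.1 < s p.2)%N && (ss2 p \notin [:: x; y; z])) =
     ((p.1 < p.2)%N && (p \notin [:: x; y; z])).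
    apply/idP/idP => /andP[h1 h2]; last by case: (twin p h1 h2) => -> ->.
    have [] := twin (ss2 p) h1 h2; rewrite /= !sK => -> + _ _ _.
    by case: (p).
  rewrite [RHS](eq_bigl _ _ dom); apply: eq_bigr => p /andP[h1 h2].
  by have [_ _ E0s _ _] := twin p h1 h2; rewrite /pair_weight /ss2 /= !ffunE E0s.
(* Each coloring is paired with its image under the exchange of the twins. This counts every
   coloring twice, and the factor 2 is cancelled below. *)
have dbl (E : rel nat) : 2%:R * csf N n E =
    \sum_k (coloring_weight E k + coloring_weight E (tw k)) * M k.
  rewrite mulr_natl mulr2n {2}/csf (reindex_inj (inv_inj twK)) /=.
  rewrite -big_split /=; apply: eq_bigr => k _.
  by rewrite -/(M (tw k)) Mtw -mulrDl.
apply: (mulfI two_neq0); rewrite mulrDr mulrCA dbl [X in _ = X + _]mulrCA !dbl.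
rewrite !mulr_sumr -big_split /=; apply: eq_bigr => k _.
have P1 k' : P E1 k' = P E0 k' by apply: PE => p h1 h2; have [] := twin p h1 h2.
have P2 k' : P E2 k' = P E0 k' by apply: PE => p h1 h2; have [] := twin p h1 h2.
rewrite !wtE !P1 !P2 Ptw.
have := loc k; rewrite /= -/(tw k) -!/(w _ _) => eq_loc.
transitivity ((1 + q) * (w E1 k + w E1 (tw k)) * (P E0 k * M k)); first by ring.
by rewrite eq_loc; ring.
Qed.

Lemma val_tperm (a b i : 'I_n) :
  val (tperm a b i) = if val i == a then val b else if val i == b then val a else val i.
Proof.
case: tpermP => [->|->|/eqP ia /eqP ib].
- by rewrite eqxx.
- by rewrite eqxx; case: ifP => // /eqP.
by rewrite -!val_eqE in ia ib; rewrite (negPf ia) (negPf ib).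
Qed.

Section Twins.
Variables (E0 E1 E2 : rel nat) (u j : nat).
Hypothesis jj : E0 j j.+1 = true.
Hypothesis twinl : forall v, (v < j)%N -> v != u -> E0 v j = E0 v j.+1.
Hypothesis twinr :
  forall w, (j.+1 < w < n)%N -> w != u -> E0 j w = E0 j.+1 w.

Let sw (v : nat) : nat := if v == j then j.+1 else if v == j.+1 then j else v.

(** The pairs formed by [u] and a twin, and the pair of twins. Both orders are listed for [u], which
    may lie on either side. *)
Let special (v w : nat) : bool := [|| (v == u) && (w == j), (v == u) && (w == j.+1),
  (v == j) && (w == u), (v == j.+1) && (w == u) | (v == j) && (w == j.+1)].

Lemma special_swap v w : (u < j)%N || (j.+1 < u)%N -> (v < w)%N ->
  special (sw v) (sw w) -> special v w.
Proof.
rewrite /special /sw; clear.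
by case: (eqVneq v j) => ?; case: (eqVneq v j.+1) => ?;
  case: (eqVneq w j) => ?; case: (eqVneq w j.+1) => ?; lia.
Qed.

Lemma twin_swap v w : (v < w < n)%N -> ~~ special v w ->
  (sw v < sw w)%N /\ E0 v w = E0 (sw v) (sw w).
Proof.
move=> vw; rewrite /special /sw => nxyz.
have vwj : (v == j) -> (w == j.+1) -> False by clear -nxyz; lia.
have vwu : (v == u) -> (w == j) || (w == j.+1) -> False by clear -nxyz; lia.
have wvu : (w == u) -> (v == j) || (v == j.+1) -> False by clear -nxyz; lia.
case: (eqVneq v j) => vj; first case: (eqVneq w j) => wj.
- by exfalso; clear -vw vj wj; lia.
- case: (eqVneq w j.+1) => wj'; first by case: vwj; apply/eqP.
  split; first by clear -vw vj wj'; lia.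
  rewrite vj; apply: twinr; first by clear -vw vj wj'; lia.
  by apply/negP => /wvu; rewrite vj eqxx; apply.
case: (eqVneq v j.+1) => vj'; first case: (eqVneq w j) => wj.
- by exfalso; clear -vw vj' wj; lia.
- have -> : (w == j.+1) = false by clear -vw vj'; lia.
  split; first by clear -vw vj'; lia.
  rewrite vj' -twinr //; first by clear -vw vj'; lia.
  by apply/negP => /wvu; rewrite vj' eqxx orbT; apply.
case: (eqVneq w j) => wj.
  split; first by clear -vw wj; lia.
  rewrite wj; apply: twinl; first by clear -vw wj; lia.
  by apply/negP => /vwu; rewrite wj eqxx; apply.
case: (eqVneq w j.+1) => wj'.
  split; first by clear -vw wj' vj; lia.
  rewrite wj' -twinl //; first by clear -vw wj' vj; lia.
  by apply/negP => /vwu; rewrite wj' eqxx orbT; apply.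
by split=> //; case/andP: vw.
Qed.

(** The intermediate graph [E1] joins [u] to the nearer twin only, so that neighbourhoods remain
    intervals. *)
Lemma csf_modular_left : (u < j)%N -> (j.+1 < n)%N ->
  [/\ E0 u j = false, E0 u j.+1 = false & E1 u j = true] ->
  [/\ E1 u j.+1 = false, E2 u j = true & E2 u j.+1 = true] ->
  (forall v w, (v < w < n)%N -> (v != u) || (w \notin [:: j; j.+1]) ->
     E1 v w = E0 v w /\ E2 v w = E0 v w) ->
  (1 + q) * csf N n E1 = q * csf N n E0 + csf N n E2.
Proof.
move=> uj jn [E0j E0j' E1j] [E1j' E2j E2j'] agree.
have jn' := ltnW jn; have un := ltn_trans uj jn'.
have [E1z E2z] : E1 j j.+1 = E0 j j.+1 /\ E2 j j.+1 = E0 j j.+1.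
  by apply: agree; clear -uj jn; lia.
pose a := Ordinal jn'; pose b := Ordinal jn; pose c := Ordinal un.
have ca : c != a by rewrite -val_eqE /= ltn_eqF.
have cb : c != b by rewrite -val_eqE /= ltn_eqF // ltnW.
have ab : a != b by rewrite -val_eqE /= ltn_eqF.
have vs i : val (tperm a b i) = sw (val i) by exact: val_tperm.
apply: (@csf_three_term _ _ _ (tperm a b) (c, a) (c, b) (a, b)).
- exact: tperm2.
- by rewrite /= !inE !xpair_eqE eqxx (negPf ab) (negPf ca).
- by rewrite /= uj ltnSn ltnW.
- have memE (p : 'I_n * 'I_n) : (p.1 < p.2)%N ->
      (p \in [:: (c, a); (c, b); (a, b)]) = special p.1 p.2.
    case: p => v w; rewrite !inE !xpair_eqE -!val_eqE /special /=.
    by clear -uj; lia.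
  case=> v w vw; rewrite memE // => nsp.
  have vwn : (v < w < n)%N by rewrite vw ltn_ord.
  have [sw_lt E0s] := twin_swap vwn nsp.
  have [-> ->] : E1 v w = E0 v w /\ E2 v w = E0 v w.
    by apply: agree => //; move: nsp; rewrite /special !inE /=; clear; lia.
  have s_lt : (tperm a b v < tperm a b w)%N by rewrite ![nat_of_ord (tperm _ _ _)]vs.
  rewrite memE //= ![nat_of_ord (tperm _ _ _)]vs; split=> //.
  by apply: contra nsp; apply: special_swap; rewrite ?uj.
move=> k /=.
rewrite /pair_weight /= !ffunE E0j E0j' E1j E1j' E2j E2j' E1z E2z jj.
rewrite tpermL tpermR (tpermD _ _) 1?eq_sym //.
by rewrite /edge_weight -!val_eqE /=; exact: three_term_left.
Qed.
Lemma csf_modular_right : (j.+1 < u < n)%N ->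
  [/\ E0 j u = false, E0 j.+1 u = false & E1 j u = false] ->
  [/\ E1 j.+1 u = true, E2 j u = true & E2 j.+1 u = true] ->
  (forall v w, (v < w < n)%N -> (w != u) || (v \notin [:: j; j.+1]) ->
     E1 v w = E0 v w /\ E2 v w = E0 v w) ->
  (1 + q) * csf N n E1 = q * csf N n E0 + csf N n E2.
Proof.
move=> /andP[uj un] [E0j E0j' E1j] [E1j' E2j E2j'] agree.
have jn := ltn_trans uj un; have jn' := ltnW jn.
have [E1z E2z] : E1 j j.+1 = E0 j j.+1 /\ E2 j j.+1 = E0 j j.+1.
  by apply: agree; clear -uj jn; lia.
pose a := Ordinal jn'; pose b := Ordinal jn; pose c := Ordinal un.
have ca : c != a by rewrite -val_eqE /= gtn_eqF // ltnW.
have cb : c != b by rewrite -val_eqE /= gtn_eqF.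
have ab : a != b by rewrite -val_eqE /= ltn_eqF.
have vs i : val (tperm a b i) = sw (val i) by exact: val_tperm.
apply: (@csf_three_term _ _ _ (tperm a b) (a, c) (b, c) (a, b)).
- exact: tperm2.
- by rewrite /= !inE !xpair_eqE (eq_sym b a) (negPf ab) (negPf cb) andbF.
- by rewrite /= uj ltnSn ltnW.
- have memE (p : 'I_n * 'I_n) : (p.1 < p.2)%N ->
      (p \in [:: (a, c); (b, c); (a, b)]) = special p.1 p.2.
    case: p => v w; rewrite !inE !xpair_eqE -!val_eqE /special /=.
    by clear -uj; lia.
  case=> v w vw; rewrite memE // => nsp.
  have vwn : (v < w < n)%N by rewrite vw ltn_ord.
  have [sw_lt E0s] := twin_swap vwn nsp.
  have [-> ->] : E1 v w = E0 v w /\ E2 v w = E0 v w.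
    by apply: agree => //; move: nsp; rewrite /special !inE /=; clear; lia.
  have s_lt : (tperm a b v < tperm a b w)%N by rewrite ![nat_of_ord (tperm _ _ _)]vs.
  rewrite memE //= ![nat_of_ord (tperm _ _ _)]vs; split=> //.
  by apply: contra nsp; apply: special_swap; rewrite ?uj ?orbT.
move=> k /=.
rewrite /pair_weight /= !ffunE E0j E0j' E1j E1j' E2j E2j' E1z E2z jj.
rewrite tpermL tpermR (tpermD _ _) 1?eq_sym //.
by rewrite /edge_weight -!val_eqE /=; exact: three_term_right.
Qed.
End Twins.
End Modular.

(** * q-numbers, and the modular law for graphs with interval neighbourhoods *)

Definition qnum (S : pzRingType) (t : S) (k : nat) : S := \sum_(i < k) t ^+ i.
Definition qfact (S : pzRingType) (t : S) (k : nat) : S := \prod_(i < k) qnum t i.+1.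

(** Equivalently, the successive differences of [f] on the window form a geometric progression of
    ratio [t]. *)
Definition qlinear (S : pzRingType) (t : S) (f : nat -> S) (lo hi : nat) : Prop :=
  forall k, (lo <= k)%N -> (k.+2 <= hi)%N ->
    (1 + t) * f k.+1 = t * f k + f k.+2.

(** With vertices numbered from 0, the value [h i] is the entry $d_{i+1}$ of a Dyck path,
    unchanged. *)
Definition hess (h : nat -> nat) : rel nat := [rel i j | (j < h i)%N].

Section Hess.
Variable N : nat.
Local Notation q := (qvar N).
Local Notation X n h := (csf N n (hess h)).

Lemma csf_hess_ext n h h' : (forall i, (i < n)%N -> minn n (h i) = minn n (h' i)) ->
  X n h = X n h'.
Proof.
move=> eqh; apply: csf_ext => i j /andP[ij jn]; rewrite /hess /=.
by have := eqh i (ltn_trans ij jn); clear -jn => e; apply/idP/idP; lia.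
Qed.

(** Consecutive vertices of the window are twins: entries within the window agree, and no entry of
    an earlier vertex other than [u] falls strictly between [lo] and [hi]. *)
Lemma qlinear_left n (h : nat -> nat -> nat) u lo hi :
  (u < lo)%N -> (hi <= n)%N ->
  (forall k, h k u = k) ->
  (forall k v, v != u -> h k v = h 0%N v) ->
  (forall v, (v < lo)%N -> v != u -> (h 0%N v <= lo)%N || (hi <= h 0%N v)%N) ->
  (forall v, (lo <= v < hi)%N -> h 0%N v = h 0%N lo) -> (hi <= h 0%N lo)%N ->
  qlinear q (fun k => X n (h k)) lo hi.
Proof.
move=> ulo hin hu hv hlow hmid hhi k lok khi.
have nu v : (lo <= v)%N -> v != u by clear -ulo; lia.
have hE k' v : (lo <= v < hi)%N -> h k' v = h 0%N lo.
  by move=> lov; rewrite hv ?hmid // nu //; case/andP: lov.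
have [hk hk1] : h k k = h 0%N lo /\ h k k.+1 = h 0%N lo.
  by split; apply: hE; clear -lok khi; lia.
apply: (@csf_modular_left _ _ _ _ _ u k); rewrite /hess /= ?hu ?hk.
- by clear -khi hhi; lia.
- move=> v vk vu; rewrite hv //; case: (ltnP v lo) => vlo.
    by have := hlow v vlo vu; clear -lok khi vk; lia.
  by rewrite hmid ?vlo //; clear -lok khi vk hhi; lia.
- by move=> w wk wu; rewrite hk1.
- by clear -ulo lok; lia.
- by clear -hin khi; lia.
- by split; clear; lia.
- by split; clear; lia.
move=> v w vw; case: (eqVneq v u) => [->|vu] //=; last by rewrite !(hv _ _ vu).
rewrite !hu !inE; clear; lia.
Qed.

(** An entry [u] stops just before the vertex [u] and an entry [u.+1] reaches it, so [k] counts the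
    vertices at the end of the window that are joined to [u]. *)
Lemma qlinear_right n (h : nat -> nat -> nat) u lo hi :
  (hi <= u)%N -> (u < n)%N ->
  (forall k v, (lo <= v < hi)%N -> h k v = if (v < hi - k)%N then u else u.+1) ->
  (forall k v, ~~ (lo <= v < hi)%N -> h k v = h 0%N v) ->
  (forall v, (v < lo)%N -> (h 0%N v <= lo)%N || (hi <= h 0%N v)%N) ->
  qlinear q (fun k => X n (h k)) 0 (hi - lo).
Proof.
move=> hiu un hmid hv hlow k _ khi.
(* From [k] to [k.+2] the vertex [u] becomes joined first to [j.+1], then to [j]; these are the
   twins. *)
pose j := (hi - k.+2)%N.
have jlo : (lo <= j)%N by rewrite /j; clear -khi; lia.
have jhi : (j.+1 < hi)%N by rewrite /j; clear -khi; lia.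
have kj : (hi - k = j.+2)%N by rewrite /j; clear -khi; lia.
have kj1 : (hi - k.+1 = j.+1)%N by rewrite /j; clear -khi; lia.
have kj2 : (hi - k.+2 = j)%N by [].
clearbody j.
have mj : (lo <= j < hi)%N by clear -jlo jhi; lia.
have mj1 : (lo <= j.+1 < hi)%N by clear -jlo jhi; lia.
apply: (@csf_modular_right _ _ _ _ _ u j); rewrite /hess /= ?(hmid _ _ mj) ?(hmid _ _ mj1) ?kj ?kj1 ?kj2.
- by case: ifP => _; clear -jhi hiu; lia.
- move=> v vj vu; case: (boolP (lo <= v < hi)%N) => vm.
    by rewrite hmid // kj; clear -vj jhi hiu; case: ifP => _; lia.
  rewrite hv //; have := hlow v; clear -vm vj jlo jhi hiu => hl.
  by have vlo : (v < lo)%N; [lia | have := hl vlo; lia].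
- by move=> w _ _; case: (ltnP j j.+2); case: (ltnP j.+1 j.+2) => //; clear; lia.
- by clear -jhi hiu un; lia.
- by clear; split; repeat case: ifP; lia.
- by clear; split; repeat case: ifP; lia.
move=> v w vw cond; case: (boolP (lo <= v < hi)%N) => vm; last by rewrite !(hv _ v vm).
rewrite !(hmid _ _ vm) kj kj1 kj2; move: cond; rewrite !inE.
clear; case: (ltngtP w u) => // wu; last first.
- by move=> /=; rewrite wu; case: (ltnP v j) => ?; case: (ltnP v j.+1) => ?; case: (ltnP v j.+2) => ?; lia.
- by case: ifP; case: ifP; case: ifP; lia.
- by case: ifP; case: ifP; case: ifP; lia.
Qed.

Lemma csf_hess_split s t h :
  (forall i, (i < s)%N -> (h i <= s)%N) ->
  X (s + t) h = X s h * X t (fun i => h (s + i) - s)%N.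
Proof.
move=> hs; rewrite csf_split => [|i j /andP[ils jgs]].
  congr (_ * _); apply: csf_ext => i j _; rewrite /hess /=.
  by clear; apply/idP/idP; lia.
by have := hs i ils; rewrite /hess /=; clear -jgs; lia.
Qed.
End Hess.

(** * Complete graphs *)

Section Complete.
Variable N : nat.
Local Notation R := {mpoly {poly int}[N]}.
Local Notation q := (qvar N).
Let complete : rel nat := fun _ _ => true.
Local Notation wt k := (coloring_weight complete k).

Lemma wt_noninj n (k : {ffun 'I_n -> 'I_N}) : ~~ injectiveb k -> wt k = 0.
Proof.
case/injectivePn => i [j ij kij]; have {ij kij} [a [b [ab kab]]] :
    exists a b : 'I_n, (a < b)%N /\ k a = k b.
  by case: (ltngtP i j) => h; [exists i, j | exists j, i | case/eqP: ij; apply: val_inj].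
by rewrite /coloring_weight (bigD1 a) //= (bigD1 b) //= /edge_weight kab eqxx !mul0r.
Qed.

(** The largest color contributes 1, and every other choice of [c] gains a factor [q] from it; this
    is the recursion [qnumS]. *)
Lemma sum_beat (S : {set 'I_N}) :
  \sum_(c in S) \prod_(d in S :\ c) edge_weight c d = qnum q #|S| :> R.
Proof.
elim: {S}_.+1 {-2}S (ltnSn #|S|) => // m IH S Sm.
have [->|[c0 c0S]] := set_0Vmem S; first by rewrite big_set0 cards0 /qnum big_ord0.
have [c cS cmax] : exists2 c, c \in S & forall d, d \in S -> (d <= c)%N.
  by case: (@arg_maxnP _ c0 (mem S) (fun i => i) c0S) => c cS cmax; exists c.
rewrite (big_setD1 c) //= (cardsD1 c) cS big1 => [|d]; last first.
  rewrite !inE => /andP[dc dS]; rewrite /edge_weight eq_sym (negPf dc).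
  by rewrite ltnNge cmax.
rewrite /qnum big_ord_recl expr0; congr (_ + _).
transitivity (q * qnum q #|S :\ c|); last first.
  by rewrite /qnum mulr_sumr; apply: eq_bigr => i _; rewrite /= -exprS.
rewrite -IH; last by move: Sm; rewrite (cardsD1 c) cS.
rewrite mulr_sumr; apply: eq_bigr => d; rewrite !inE => /andP[dc dS].
rewrite (big_setD1 c) /=; last by rewrite !inE eq_sym dc.
rewrite /edge_weight (negPf dc) ltn_neqAle cmax // val_eqE dc /=.
by congr (_ * _); apply: eq_bigl => e; rewrite !inE andbCA.
Qed.

(** By induction: the color of the first vertex contributes a q-number by [sum_beat], and the other
    vertices use the remaining colors. *)
Lemma sum_wt_in n (S : {set 'I_N}) : #|S| = n ->
  \sum_(k : {ffun 'I_n -> 'I_N} | [forall i, k i \in S]) wt k = qfact q n.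
Proof.
elim: n S => [|n IH] S cardS.
  have k0 : forall k : {ffun 'I_0 -> 'I_N}, k = ffun0 (card_ord 0).
    by move=> k; apply/ffunP; case.
  rewrite (big_pred1 (ffun0 (card_ord 0))) => [|k].
    by rewrite /coloring_weight /qfact !big_ord0.
  by rewrite (k0 k) [RHS]eqxx; apply/forallP; case.
rewrite big_mkcond (sum_join_ffun (s := 1)) /=.
rewrite (reindex (fun c => [ffun _ : 'I_1 => c])) /=; last first.
  exists (fun k1 => k1 ord0) => [c _|k1 _]; first by rewrite ffunE.
  by apply/ffunP => i; rewrite ffunE (ord1 i).
transitivity (\sum_(c in S) (\prod_(d in S :\ c) edge_weight c d) * qfact q n).
  rewrite [RHS]big_mkcond; apply: eq_bigr => c _.
  pose jn (k : {ffun 'I_n -> 'I_N}) := join_ffun [ffun _ : 'I_1 => c] k.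
  have jn0 k : jn k ord0 = c.
    by rewrite /jn (_ : @ord0 n = @lshift 1 n ord0) ?join_ffunl ?ffunE //; apply: val_inj.
  have jnS k i : jn k (lift ord0 i) = k i.
    by rewrite /jn (_ : lift (@ord0 n) i = @rshift 1 n i) ?join_ffunr //; apply: val_inj.
  have wtjn k : wt (jn k) = (\prod_j edge_weight c (k j)) * wt k.
    rewrite /coloring_weight big_ord_recl; congr (_ * _).
      rewrite big_mkcond big_ord_recl /= mul1r; apply: eq_bigr => j _.
      by rewrite jn0 jnS.
    apply: eq_bigr => i _; rewrite big_mkcond big_ord_recl /= mul1r [RHS]big_mkcond.
    by apply: eq_bigr => j _; rewrite /= !jnS /bump !add1n ltnS.
  have jnin k : [forall i, jn k i \in S] = (c \in S) && [forall i, k i \in S].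
    apply/forallP/andP => [kS|[cS /forallP kS] i].
      by split; [rewrite -(jn0 k) | apply/forallP => i; rewrite -jnS].
    by case: (unliftP ord0 i) => [j|] ->; rewrite ?jn0 ?jnS.
  rewrite -/(jn _); case: ifPn => cS; last first.
    by rewrite big1 // => k _; rewrite -/(jn k) jnin (negPf cS).
  rewrite -(IH (S :\ c)); last by move: cardS; rewrite (cardsD1 c) cS => -[].
  rewrite big_distrr /= [RHS]big_mkcond; apply: eq_bigr => k _.
  rewrite -/(jn k) jnin cS wtjn /=.
  have [inj|ninj] := boolP (injectiveb k); last first.
    by rewrite wt_noninj // !mulr0 !if_same.
  case: ifPn => kS; last first.
    rewrite ifN //; apply: contra kS => /forallP kS; apply/forallP => i.
    by have := kS i; rewrite !inE => /andP[].
  case: ifPn => kSc; last first.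
    move: kSc; rewrite negb_forall => /existsP[i]; rewrite !inE.
    rewrite (forallP kS) andbT negbK => /eqP kc.
    by rewrite (bigD1 i) //= /edge_weight kc eqxx !mul0r.
  (* An injective coloring with colors in [S :\ c] uses all of them, by cardinality. *)
  congr (_ * _); have -> : S :\ c = k @: setT.
    apply/esym/eqP; rewrite eqEcard; apply/andP; split.
      by apply/subsetP => d /imsetP[i _ ->]; apply: (forallP kSc).
    rewrite card_imset; last exact/injectiveP.
    by rewrite cardsT card_ord; move: cardS; rewrite (cardsD1 c) cS => -[<-].
  rewrite big_imset /=; last by move=> i j _ _; move/injectiveP: inj; apply.
  by apply: eq_bigl => i; rewrite inE.
by rewrite -big_distrl /= sum_beat cardS /qfact big_ord_recr /= mulrC.
Qed.

(** Proper colorings are grouped by their image, an [n]-element set that yields one monomial of the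
    elementary symmetric function. *)
Lemma csf_complete n : csf N n complete = qfact q n * mesym N {poly int} n.
Proof.
rewrite /mesym mulr_sumr /csf.
rewrite (partition_big (fun k : {ffun 'I_n -> 'I_N} => k @: setT) predT) //=.
rewrite [RHS]big_mkcond; apply: eq_bigr => S _; case: eqP => cardS; last first.
  apply: big1 => k /eqP kS; rewrite wt_noninj ?mul0r //.
  apply/negP => /injectiveP inj; apply: cardS.
  by rewrite -kS card_imset // cardsT card_ord.
rewrite -(sum_wt_in cardS) mulr_suml [LHS]big_mkcond [RHS]big_mkcond.
apply: eq_bigr => k _; have [inj|ninj] := boolP (injectiveb k); last first.
  by rewrite wt_noninj // !mul0r !if_same.
have -> : (k @: setT == S) = [forall i, k i \in S].
  apply/eqP/forallP => [<- i|kS]; first by rewrite imset_f.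
  apply/eqP; rewrite eqEcard cardS card_imset ?cardsT ?card_ord ?leqnn ?andbT.
    by apply/subsetP => d /imsetP[i _ ->].
  exact/injectiveP.
case: ifPn => // /forallP kS; congr (_ * _).
have -> : S = k @: setT.
  apply/esym/eqP; rewrite eqEcard cardS card_imset ?cardsT ?card_ord ?leqnn ?andbT.
    by apply/subsetP => d /imsetP[i _ ->].
  exact/injectiveP.
rewrite big_imset /=; last by move=> i j _ _; move/injectiveP: inj; apply.
by apply: eq_bigl => i; rewrite inE.
Qed.
End Complete.

(** * Cliques with a few vertices attached *)

(* The vertices past the explicit entries [s] form a clique up to [n - 2], and
   the last vertex [n - 1] is joined to the last [b] vertices before it. *)
Definition clique_path (n : nat) (s : seq nat) (b : nat) (v : nat) : nat :=
  nth (if (v < n.-1 - b)%N then n.-1 else n) s v.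

Section Families.
Variable N : nat.
Local Notation q := (qvar N).

Definition XG (n : nat) (s : seq nat) (b : nat) : {mpoly {poly int}[N]} :=
  csf N n (hess (clique_path n s b)).

(** The chromatic function of a clique, in the closed form of [csf_complete]. *)
Definition cl (n : nat) : {mpoly {poly int}[N]} :=
  qfact q n * mesym N {poly int} n.

Lemma XG_eq n s b s' b' :
  (forall v, (v < n)%N -> minn n (clique_path n s b v) = minn n (clique_path n s' b' v)) ->
  XG n s b = XG n s' b'.
Proof. exact: csf_hess_ext. Qed.

Lemma clique_path_default n s b v : (size s <= v)%N ->
  clique_path n s b v = if (v < n.-1 - b)%N then n.-1 else n.
Proof. exact: nth_default. Qed.

Lemma nth_cat_cons (s1 s2 : seq nat) x d v :
  nth d (s1 ++ x :: s2) v = if v == size s1 then x else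
    nth d (s1 ++ 0%N :: s2) v.
Proof.
rewrite !nth_cat; case: (ltngtP v (size s1)) => // [vs|->]; last by rewrite subnn.
by case: (v - size s1)%N (subn_gt0 (size s1) v) => [|k]; rewrite // vs.
Qed.

(** The numerical condition makes the window consist of twins: none or all of its vertices are
    joined to the last vertex, and if the window reaches the last vertex itself, all default entries
    equal [n]. *)
Lemma XG_qlinear_entry n (s1 s2 : seq nat) b lo hi :
  (size s1 + size s2 < lo)%N -> (hi <= n)%N ->
  (hi <= n.-1 - b)%N || (n.-1 - b <= lo)%N &&
     ((hi <= n.-1)%N || (n.-1 - b <= (size s1 + size s2).+1)%N) ->
  all (fun x => (x <= lo) || (hi <= x))%N (s1 ++ s2) ->
  qlinear q (fun k => XG n (s1 ++ k :: s2) b) lo hi.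
Proof.
move=> slo hin hb /allP s_ok.
have szs k : size (s1 ++ k :: s2) = (size s1 + size s2).+1 by rewrite size_cat addnS.
apply: (@qlinear_left _ _ _ (size s1)) => //.
- by move: slo; clear; lia.
- by move=> k; rewrite /clique_path nth_cat_cons eqxx.
- move=> k v vs; rewrite /clique_path nth_cat_cons (negPf vs).
  by rewrite [RHS]nth_cat_cons (negPf vs).
- move=> v vlo vs; rewrite /clique_path.
  case: (ltnP v (size (s1 ++ 0%N :: s2))) => vsz; last first.
    rewrite nth_default //; move: vlo hin hb vsz; rewrite szs; clear.
    by case: (ltnP v (n.-1 - b)); lia.
  apply: s_ok; move: vsz vs; rewrite mem_cat nth_cat size_cat /=.
  case: (ltnP v (size s1)) => [h _ _|vs1 vsz vs]; first by rewrite mem_nth.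
  have [w vw] : exists w, v = (size s1 + w).+1.
    by exists (v - size s1).-1; move: vs1 vs; clear; lia.
  rewrite vw -addnS addKn /= mem_nth ?orbT //.
  by move: vsz; rewrite vw -addnS ltn_add2l ltnS.
- move=> v vm; rewrite !clique_path_default ?szs //; last first.
    by move: vm slo; clear; lia.
  by move: hb vm; clear; case: (ltnP v (n.-1 - b)); case: (ltnP lo (n.-1 - b)); lia.
rewrite clique_path_default ?szs //; move: hb hin; clear.
by case: (ltnP lo (n.-1 - b)); lia.
Qed.

Lemma XG_qlinear_last n (s : seq nat) b0 b1 :
  (b1 + size s < n)%N ->
  all (fun x => (x <= n.-1 - b1) || (n.-1 - b0 <= x))%N s ->
  qlinear q (XG n s) b0 b1.
Proof.
move=> bn /allP s_ok k bk kb.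
(* The minimum freezes the family past [b1], since [qlinear_right] wants the entries outside the
   window to be constant for every index. *)
pose h i v := clique_path n s (b0 + minn i (b1 - b0)) v.
have := @qlinear_right N n h n.-1 (n.-1 - b1) (n.-1 - b0) (leq_subr _ _).
have -> : (n.-1 - b0 - (n.-1 - b1) = b1 - b0)%N by move: bn bk kb; clear; lia.
move=> /(_ _ _ _ _ (k - b0)%N isT) lin.
have XE i : (b0 + i <= b1)%N -> csf N n (hess (h i)) = XG n s (b0 + i).
  by move=> bi; rewrite /h /XG (minn_idPl _) //; move: bi; clear; lia.
have e1 : (b0 + (k - b0).+1 = k.+1)%N by move: bk; clear; lia.
have e2 : (b0 + (k - b0).+2 = k.+2)%N by move: bk; clear; lia.
have := lin; rewrite !XE ?e1 ?e2 ?subnKC //; try by move: kb; clear; lia.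
apply.
- by move: bn; case: (n).
- move=> i v vm; rewrite /h clique_path_default; last first.
    by move: bn vm; clear; set z := size s; lia.
  have -> : n.-1.+1 = n by move: bn; clear; lia.
  by case: (ltnP v _) => h1; case: (ltnP v _) => h2 //; move: vm h1 h2; clear; lia.
- move=> i v vm; rewrite /h /clique_path; congr nth.
  by case: (ltnP v _) => h1; case: (ltnP v _) => h2 //; move: vm h1 h2; clear; lia.
- move=> v vb; rewrite /h /clique_path.
  case: (ltnP v (size s)) => vs; first by apply: s_ok; rewrite mem_nth.
  rewrite nth_default //; case: ifP => _; move: bn; clear; lia.
- by move: bk kb; clear; lia.
Qed.

(** The vertex [u] is the extra vertex on the right, and the twins are the two vertices whose
    entries change. The condition on [s1] says that no earlier neighbourhood separates them. *)
Lemma XG_diag n (s1 s2 : seq nat) b u : ((size s1).+2 <= u < n)%N ->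
  (size s1).+1 \notin s1 ->
  (1 + q) * XG n (s1 ++ [:: u, u.+1 & s2]) b =
    q * XG n (s1 ++ [:: u, u & s2]) b + XG n (s1 ++ [:: u.+1, u.+1 & s2]) b.
Proof.
move=> /andP[su un] s1_ok; set t := size s1.
pose E k := s1 ++ [:: (if (k < 2)%N then u else u.+1), (if (k < 1)%N then u else u.+1) & s2].
pose h k := clique_path n (E k) b.
have := @qlinear_right N n h u t t.+2 su un _ _ _ 0%N isT.
have -> : (t.+2 - t = 2)%N by clear; lia.
apply=> //.
- move=> k v vm; rewrite /h /clique_path /E nth_cat ltnNge.
  have -> : (size s1 <= v)%N by move: vm; rewrite /t; clear; lia.
  rewrite /= -/t; have [->|->] : v = t \/ v = t.+1 by move: vm; clear; lia.
    by rewrite subnn /= (_ : (t < t.+2 - k)%N = (k < 2)%N) //; clear; apply/idP/idP; lia.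
  by rewrite subSnn /= (_ : (t.+1 < t.+2 - k)%N = (k < 1)%N) //; clear; apply/idP/idP; lia.
- move=> k v vm; rewrite /h /clique_path /E !nth_cat; case: ltnP => // tv.
  have [w vw] : exists w, v = (size s1 + w)%N by exists (v - size s1)%N; rewrite subnKC.
  rewrite {tv}vw {v}addKn in vm *; case: w vm => [|[|w]] //.
    by rewrite addn0 /t leqnn ltnS leqnSn.
  by rewrite addn1 /t leqnSn ltnSn.
- move=> v vt; rewrite /h /clique_path /E nth_cat vt.
  have := mem_nth (if (v < n.-1 - b)%N then n.-1 else n) vt.
  set x := nth _ _ _ => xs; have : x != t.+1 by apply: contraNneq s1_ok => <-.
  by clear; lia.
Qed.

Lemma XG_split t m (s : seq nat) b : size s = t -> all (fun x => x <= t)%N s ->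
  (b < m)%N ->
  XG (t + m) s b = XG t s t * XG m [::] b.
Proof.
move=> st /allP s_ok bm; rewrite /XG csf_hess_split => [|i it].
  congr (_ * _); apply: csf_hess_ext => i ilt; rewrite /clique_path.
    by congr minn; apply: set_nth_default; rewrite st.
  rewrite nth_default ?st ?leq_addr // nth_default //.
  have -> : (t + i < (t + m).-1 - b)%N = (i < m.-1 - b)%N by move: bm; clear => ?; apply/idP/idP; lia.
  by case: ifP => _; move: bm; clear; lia.
by apply: s_ok; rewrite mem_nth ?st.
Qed.

Lemma XG_complete n (s : seq nat) b : all (leq n) s -> (n <= (size s + b).+1)%N -> XG n s b = cl n.
Proof.
move=> /allP s_ok nb; rewrite /XG /cl -csf_complete; apply: csf_ext => i j ijn.
rewrite /hess /clique_path /=; case: (ltnP i (size s)) => iss.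
  have := s_ok _ (mem_nth (if (i < n.-1 - b)%N then n.-1 else n) iss).
  set x := nth _ _ _; move: ijn; clear; lia.
rewrite nth_default //; case: ifP; move: nb ijn iss; clear; lia.
Qed.

(** Without its isolated last vertex the clique extends to the end; the last argument [n] expresses
    this, as all default entries become [n]. *)
Lemma XG_last n (s : seq nat) : all (fun x => x <= n)%N s ->
  XG n.+1 s 0 = XG n s n * cl 1.
Proof.
move=> /allP s_ok; rewrite /XG -addn1 csf_hess_split => [|i it].
  congr (_ * _).
    apply: csf_hess_ext => i ilt; rewrite /clique_path addn1 /= subn0 ilt.
    case: (ltnP i (size s)) => iss; first by congr minn; apply: set_nth_default.
    by rewrite !nth_default //; case: ifP; move: ilt; clear; lia.
  by rewrite /cl -csf_complete; apply: csf_ext => i j; clear; lia.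
rewrite /clique_path addn1 /= subn0 it; case: (ltnP i (size s)) => iss.
  by apply: s_ok; rewrite mem_nth.
by rewrite nth_default.
Qed.

Lemma XG_absorb_last n s b : (size s < n.-1 - b)%N ->
  XG n (rcons s n.-1) b = XG n s b.
Proof.
move=> sb; apply: XG_eq => v vn; rewrite /clique_path nth_rcons.
case: ltngtP => // [vs|->]; first by rewrite nth_default // ltnW.
by rewrite nth_default // sb.
Qed.

Lemma XG_absorb_full n s b : (n.-1 - b <= size s)%N ->
  XG n (rcons s n) b = XG n s b.
Proof.
move=> sb; apply: XG_eq => v vn; rewrite /clique_path nth_rcons.
case: ltngtP => // [vs|->]; first by rewrite nth_default // ltnW.
by rewrite nth_default // ltnNge sb.
Qed.

(** Writing out the default entries [n.-1] lets the last vertex be counted in the clique, and its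
    non-neighbours be counted among the vertices on the left. This is the exchange of roles. *)
Lemma XG_expand n s j b b' : (n.-1 - b = size s + j)%N -> (n.-1 - b' <= size s + j)%N ->
  XG n s b = XG n (s ++ nseq j n.-1) b'.
Proof.
move=> bj bj'; apply: XG_eq => v vn; rewrite /clique_path nth_cat bj.
case: (ltnP v (size s)) => vs.
  by rewrite (set_nth_default (if (v < n.-1 - b')%N then n.-1 else n)).
rewrite nth_default // nth_nseq ltn_subLR //.
by case: (ltnP v (size s + j)) => // vsj; rewrite ltnNge (leq_trans bj').
Qed.
End Families.

(** * Solving the linear relations *)

Section QNum.
Variables (S : comPzRingType) (t : S).
Local Notation qn := (qnum t).

Lemma qnum0 : qn 0 = 0. Proof. by rewrite /qnum big_ord0. Qed.

Lemma qnumS k : qn k.+1 = 1 + t * qn k.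
Proof.
rewrite /qnum big_ord_recl expr0 mulr_sumr; congr (_ + _).
by apply: eq_bigr => i _; rewrite -exprS.
Qed.

Lemma qnum1 : qn 1 = 1. Proof. by rewrite qnumS qnum0 mulr0 addr0. Qed.

(** With [qnumD], this turns symbolic exponents and indices into polynomials in q-numbers, which
    [ring] and [field] can compare. *)
Lemma expr_qnum k : t ^+ k = 1 + (t - 1) * qn k.
Proof. by elim: k => [|k IH]; rewrite ?qnum0 ?expr0 ?qnumS ?exprS ?IH; ring. Qed.

Lemma qnumD a b : qn (a + b)%N = qn a + qn b + (t - 1) * qn a * qn b.
Proof. by elim: a => [|a IH]; rewrite ?addSn ?qnumS ?IH ?add0n ?qnum0; ring. Qed.

Lemma qnum_sub k n : (k <= n)%N -> t ^+ k * qn (n - k)%N = qn n - qn k.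
Proof. by move=> kn; rewrite -{2}(subnKC kn) qnumD expr_qnum; ring. Qed.

Lemma qfactS k : qfact t k.+1 = qn k.+1 * qfact t k.
Proof. by rewrite /qfact big_ord_recr mulrC. Qed.

Lemma qfact0 : qfact t 0 = 1. Proof. by rewrite /qfact big_ord0. Qed.

Lemma qlinear_slope f lo hi k : qlinear t f lo hi -> (lo + k <= hi)%N ->
  f (lo + k)%N = f lo + qn k * (f lo.+1 - f lo).
Proof.
move=> lin; elim: k {-2}k (leqnn k) => [|m IH] [|[|k]] //= km khi;
  rewrite ?addn0 ?addn1 ?qnum0 ?qnum1; try by ring.
have := lin (lo + k)%N (leq_addr _ _); rewrite -!addnS => /(_ khi) rel.
have -> : f (lo + k.+2)%N = (1 + t) * f (lo + k.+1)%N - t * f (lo + k)%N.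
  by rewrite rel; ring.
rewrite !IH ?qnumS; try by move: km khi; clear; lia.
by ring.
Qed.
End QNum.

Lemma qlinear_shift (S : pzRingType) (t : S) (f : nat -> S) a lo hi :
  qlinear t f (a + lo) (a + hi) -> qlinear t (fun k => f (a + k)%N) lo hi.
Proof.
move=> lin k lok khi; rewrite !addnS; apply: lin; first by rewrite leq_add2l.
by rewrite -!addnS leq_add2l.
Qed.

Section Solve.
Variables (K : fieldType) (q : K).
Local Notation qn := (qnum q).
Hypothesis qnum_neq0 : forall k, qn k.+1 != 0.

Lemma qlinear_interp f lo d k : qlinear q f lo (lo + d.+1) -> (k <= d.+1)%N ->
  f (lo + k)%N = f lo + qn k / qn d.+1 * (f (lo + d.+1)%N - f lo).
Proof.
move=> lin kd; rewrite (qlinear_slope lin (leqnn _)) (qlinear_slope lin) ?leq_add2l //.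
by field.
Qed.

(** The model is a pair of adjacent vertices joined to the first [i] and the first [j] vertices of a
    clique, with [i <= j]. The last relation links rows 0 and 1. *)
Definition pair_family (M : nat) (v : nat -> nat -> K) : Prop :=
  [/\ forall i, (i <= M)%N -> qlinear q (v i) i M,
      forall j, (j <= M)%N -> qlinear q (v^~ j) 0 j
    & (0 < M)%N -> (1 + q) * v 0%N 1%N = q * v 0%N 0%N + v 1%N 1%N].

(** Three values suffice: [v 0 0] and [v 0 1] give row 0, the diagonal relation gives [v 1 1], row 1
    then follows from [v 1 2], and each column from rows 0 and 1. *)
Lemma pair_family_affine M v i j : pair_family M v -> (i <= j <= M)%N ->
  v i j = v 0%N 0%N + (v 0%N 1%N - v 0%N 0%N) * (qn j + q * qn i)
    + (v 1%N 2%N - v 0%N 0%N - (v 0%N 1%N - v 0%N 0%N) * (1 + q + q)) * qn i * qn j.-1.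
Proof.
case=> linj lini diag /andP[ij jM].
have v0 l : (l <= M)%N -> v 0%N l = v 0%N 0%N + qn l * (v 0%N 1%N - v 0%N 0%N).
  by move=> lM; rewrite -(qlinear_slope (linj 0%N (leq0n _))).
case: j ij jM => [|j] ij jM.
  by move: ij; rewrite leqn0 => /eqP ->; rewrite qnum0; ring.
have := diag (leq_trans (ltn0Sn j) jM) => {}diag.
have v11 : v 1%N 1%N = (1 + q) * v 0%N 1%N - q * v 0%N 0%N by rewrite diag; ring.
have v1 : v 1%N j.+1 = v 1%N 1%N + qn j * (v 1%N 2%N - v 1%N 1%N).
  by rewrite -(qlinear_slope (linj 1%N (leq_trans (ltn0Sn j) jM))) ?add1n.
have := qlinear_slope (k := i) (lini j.+1 jM) ij; rewrite add0n => ->.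
by rewrite v1 v0 // v11 qnumS; ring.
Qed.

(** The same affine form, with its coefficients read off at the corners, where the graphs are
    simpler. *)
Lemma pair_family_corners M v i j : pair_family M.+2 v -> (i <= j <= M.+2)%N ->
  let A := v 0%N 0%N in let B := v 0%N M.+2 in let C := v M.+2 M.+2 in
  v i j = A + (B - A) / qn M.+2 * (qn j + q * qn i)
    + (C - A - (B - A) * (1 + q)) / (qn M.+2 * qn M.+1) * qn i * qn j.-1.
Proof.
move=> pf ij A B C; rewrite (pair_family_affine pf ij) {}/A {}/B {}/C.
rewrite (@pair_family_affine _ _ 0 M.+2 pf) ?leqnn //.
rewrite (@pair_family_affine _ _ M.+2 M.+2 pf) ?leqnn // qnum0 /=.
have := qnum_neq0 M.+1; rewrite [qn M.+2]qnumS => nz2.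
by field; rewrite qnum_neq0 nz2.
Qed.

(** The relations between the functions [XG], stated over a field so that q-numbers can be
    inverted. *)
Record clique_path_laws (x : nat -> seq nat -> nat -> K) (c : nat -> K) : Prop :=
  CliquePathLaws {
  x_entry n (s1 s2 : seq nat) b lo hi : (size s1 + size s2 < lo)%N -> (hi <= n)%N ->
    (hi <= n.-1 - b)%N || (n.-1 - b <= lo)%N &&
       ((hi <= n.-1)%N || (n.-1 - b <= (size s1 + size s2).+1)%N) ->
    all (fun x => (x <= lo) || (hi <= x))%N (s1 ++ s2) ->
    qlinear q (fun k => x n (s1 ++ k :: s2) b) lo hi;
  x_last n (s : seq nat) b0 b1 : (b1 + size s < n)%N ->
    all (fun x => (x <= n.-1 - b1) || (n.-1 - b0 <= x))%N s ->
    qlinear q (x n s) b0 b1;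
  x_diag n (s1 s2 : seq nat) b u : ((size s1).+2 <= u < n)%N ->
    (size s1).+1 \notin s1 ->
    (1 + q) * x n (s1 ++ [:: u, u.+1 & s2]) b =
      q * x n (s1 ++ [:: u, u & s2]) b + x n (s1 ++ [:: u.+1, u.+1 & s2]) b;
  x_split t m (s : seq nat) b : size s = t -> all (fun x => x <= t)%N s ->
    (b < m)%N -> x (t + m)%N s b = x t s t * x m [::] b;
  x_complete n (s : seq nat) b : all (leq n) s -> (n <= (size s + b).+1)%N ->
    x n s b = c n;
  x_isolated n (s : seq nat) : all (fun x => x <= n)%N s ->
    x n.+1 s 0%N = x n s n * c 1%N;
  x_absorb_last n s b : (size s < n.-1 - b)%N -> x n (rcons s n.-1) b = x n s b;
  x_absorb_full n s b : (n.-1 - b <= size s)%N -> x n (rcons s n) b = x n s b;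
  x_expand n s j b b' : (n.-1 - b = size s + j)%N ->
    (n.-1 - b' <= size s + j)%N -> x n s b = x n (s ++ nseq j n.-1) b' }.

Variables (x : nat -> seq nat -> nat -> K) (c : nat -> K).
Hypothesis laws : clique_path_laws x c.

Lemma x_full n s b b' : (size s <= n.-1)%N -> (n.-1 - b <= size s)%N ->
  (n.-1 - b' <= size s)%N -> x n s b = x n s b'.
Proof.
move=> sn sb sb'; have sz : (n.-1 - (n.-1 - size s) = size s + 0)%N by lia.
have := x_expand laws (b' := b) sz; rewrite addn0 cats0 => <- //.
by have := x_expand laws (b' := b') sz; rewrite addn0 cats0 => <-.
Qed.

(* A clique of size [m + 1] with one extra vertex at either end. *)
Lemma x_pendant_right m b : (b <= m.+1)%N ->
  x m.+2 [::] b = c m.+1 * c 1%N + qn b / qn m.+1 * (c m.+2 - c m.+1 * c 1%N).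
Proof.
move=> bm; have lin : qlinear q (x m.+2 [::]) 0 m.+1.
  by apply: (x_last laws) => //=; lia.
have := @qlinear_interp _ 0 m b lin bm; rewrite !add0n => ->.
rewrite (x_isolated laws) // !(x_complete (n := m.+1) laws) //=; try lia.
by rewrite (x_complete (n := m.+2) laws).
Qed.

Lemma x_pendant_left m r : (r <= m.+1)%N ->
  x m.+2 [:: r.+1] m.+2 = c m.+1 * c 1%N + qn r / qn m.+1 * (c m.+2 - c m.+1 * c 1%N).
Proof.
move=> rm; have lin : qlinear q (fun k => x m.+2 [:: k] m.+2) 1 m.+2.
  by apply: (x_entry laws (s1 := [::]) (s2 := [::])) => //=; lia.
have := @qlinear_interp _ 1 m r lin rm; rewrite !add1n => ->.
rewrite (x_complete (n := m.+2) (s := [:: m.+2]) laws) /=; try lia.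
have -> : x m.+2 [:: 1%N] m.+2 = c m.+1 * c 1%N.
  rewrite (@x_full _ _ _ m) /=; try lia.
  rewrite (x_split laws (t := 1) (m := m.+1)) //= mulrC.
  by rewrite !(x_complete (n := 1) laws) // !(x_complete (n := m.+1) laws) //=; lia.
by [].
Qed.

(** The pair comes right after the explicit entries [s], and [t] is the first vertex after the pair:
    an entry [t + i] reaches [i] vertices beyond it. *)
Lemma pair_family_x n (s : seq nat) b M : let t := (size s).+2 in
  all (fun y => y <= t)%N s -> t.-1 \notin s -> (t < n)%N ->
  (t + M <= n.-1 - b)%N || (n.-1 - b <= t)%N && (t + M <= n)%N ->
  pair_family M (fun i j => x n (s ++ [:: t + i; t + j]%N) b).
Proof.
move=> t s_ok t_ok tn bM; split=> [i iM|j jM|M0].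
- apply: (qlinear_shift (f := fun k => x n (s ++ [:: t + i; k]%N) b)).
  suff lin : qlinear q (fun k => x n (rcons s (t + i)%N ++ k :: [::]) b) (t + i) (t + M).
    by move=> k; have := lin k; rewrite !cat_rcons.
  apply: (x_entry laws); rewrite ?size_rcons ?addn0 ?cats0 ?all_rcons.
  - by rewrite /t; lia.
  - by move: bM tn; lia.
  - by move: bM iM; rewrite /t; lia.
  - by rewrite leqnn; apply: sub_all s_ok => y yt; lia.
- apply: (qlinear_shift (f := fun k => x n (s ++ [:: k; t + j]%N) b)).
  apply: (x_entry laws) => /=.
  - by rewrite /t; lia.
  - by move: bM tn jM; lia.
  - by move: bM jM; rewrite /t; lia.
  - rewrite all_cat /= leqnn orbT !andbT; apply: sub_all s_ok => y yt; lia.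
by have := x_diag laws (n := n) (s1 := s) [::] b (u := t); rewrite !addn0 addn1; apply; rewrite ?leqnn.
Qed.

(** The value of a clique of size [k] with a further vertex attached to just one of its vertices. *)
Definition pend k := c k * c 1%N + (c k.+1 - c k * c 1%N) / qn k.

Lemma x_pend k : x k.+2 [:: 2%N] k.+2 = pend k.+1.
Proof. by rewrite x_pendant_left // qnum1 /pend mulrC mul1r [_^-1 * _]mulrC. Qed.

Lemma x_two m : pair_family m.+1 (fun i j => x m.+3 [:: i.+2; j.+2] m.+3).
Proof. by apply: (@pair_family_x m.+3 [::] m.+3 m.+1) => //=; lia. Qed.

Lemma x_two00 m : x m.+3 [:: 2; 2]%N m.+3 = c 2%N * c m.+1.
Proof.
rewrite (@x_full _ _ _ m) /=; try lia.
rewrite (x_split laws (t := 2) (m := m.+1)) //=.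
by rewrite !(x_complete (n := 2) laws) // !(x_complete (n := m.+1) laws) //=; lia.
Qed.

Lemma x_two0m m : x m.+3 [:: 2; m.+3]%N m.+3 = pend m.+2.
Proof. by rewrite (x_absorb_full laws (s := [:: 2%N])) ?x_pend //; lia. Qed.

Lemma x_two_row0 m j : (j <= m.+1)%N -> x m.+3 [:: 2; j.+2]%N m.+3 =
  c 2%N * c m.+1 + qn j / qn m.+1 * (pend m.+2 - c 2%N * c m.+1).
Proof.
move=> jm; have [lin _ _] := x_two m.
by rewrite (@qlinear_interp _ 0 m j (lin _ (leq0n _)) jm) x_two00 x_two0m.
Qed.

(** The corners are two disjoint cliques, a clique with a pendant vertex, and a complete graph. *)
Lemma x_two_val m i j : (i <= j <= m.+2)%N -> x m.+4 [:: i.+2; j.+2]%N m.+4 =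
  let A := c 2%N * c m.+2 in
  A + (pend m.+3 - A) / qn m.+2 * (qn j + q * qn i)
    + (c m.+4 - A - (pend m.+3 - A) * (1 + q)) / (qn m.+2 * qn m.+1) * qn i * qn j.-1.
Proof.
move=> ij; rewrite (pair_family_corners (x_two m.+1) ij) x_two00 x_two0m.
by rewrite (x_complete (n := m.+4) laws) //=; lia.
Qed.

(* A clique of size [m + 2] with one extra vertex at either end, the two
   attaching intervals being disjoint. *)
Lemma x_ends m r b : (r + b <= m.+2)%N -> x m.+4 [:: r.+1] b =
  let k11 := c 1%N * c 1%N * c m.+2 in
  let s := c 1%N * (c m.+3 - c m.+2 * c 1%N) / qn m.+2 in
  k11 + s * (qn r + qn b)
    + (c 2%N * c m.+2 + qn m.+1 / qn m.+2 * (pend m.+3 - c 2%N * c m.+2)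
       - k11 - s * (1 + qn m.+1)) / qn m.+1 * qn r * qn b.
Proof.
move=> rb /=.
have F0 b' : (b' <= m.+2)%N -> x m.+4 [:: 1%N] b' =
    c 1%N * (c m.+2 * c 1%N + qn b' / qn m.+2 * (c m.+3 - c m.+2 * c 1%N)).
  move=> bm; rewrite (x_split laws (t := 1) (m := m.+3)) //=.
  by rewrite (x_complete (n := 1) laws) // x_pendant_right.
case: r rb => [|r] rb; first by rewrite F0 ?qnum0 //; ring.
have F10 : x m.+4 [:: 2%N] 0 =
    c 1%N * (c m.+2 * c 1%N + qn 1 / qn m.+2 * (c m.+3 - c m.+2 * c 1%N)).
  by rewrite (x_isolated laws) //= x_pendant_left // mulrC.
(* For [r = 1] and the largest [b], the last vertex is counted in the clique, and the one clique
   vertex that it misses becomes the second vertex of a pair on the left. *)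
have F1m : x m.+4 [:: 2%N] m.+1 =
    c 2%N * c m.+2 + qn m.+1 / qn m.+2 * (pend m.+3 - c 2%N * c m.+2).
  rewrite (x_expand laws (j := 1) (b' := m.+4)) /=; try lia.
  by rewrite x_two_row0.
have lin1 : qlinear q (x m.+4 [:: 2%N]) 0 m.+1.
  by apply: (x_last laws) => //=; lia.
have := @qlinear_interp _ 0 m b lin1; rewrite !add0n F10 F1m => F1b.
have linr : qlinear q (fun k => x m.+4 [:: k] b) 1 (m.+3 - b).
  by apply: (x_entry laws (s1 := [::]) (s2 := [::])) => //=; lia.
have := @qlinear_slope _ _ _ 1 _ r.+1 linr; rewrite add1n => ->; last by lia.
rewrite F1b ?F0; try lia; rewrite qnum1.
by field; rewrite !qnum_neq0.
Qed.

(* Two adjacent vertices to the left of a clique of size [m] and one vertex to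
   its right. *)
Lemma pair_family_two_left m b : (b <= m)%N ->
  pair_family (m - b) (fun i j => x m.+3 [:: i.+2; j.+2] b).
Proof.
by move=> bm; apply: (@pair_family_x m.+3 [::] b (m - b)) => //=; lia.
Qed.

Lemma x_two_left_b0 m i j : (i <= j <= m)%N ->
  x m.+3 [:: i.+2; j.+2] 0 = c 1%N * x m.+2 [:: i.+2; j.+2] m.+2.
Proof.
by move=> ij; rewrite (x_isolated laws) //=; [rewrite mulrC | lia].
Qed.

Lemma x_two_left_00 m b : (b <= m.+1)%N -> x m.+4 [:: 2; 2]%N b =
  c 2%N * (c m.+1 * c 1%N + qn b / qn m.+1 * (c m.+2 - c m.+1 * c 1%N)).
Proof.
move=> bm; rewrite (x_split laws (t := 2) (m := m.+2)) //=.
by rewrite (x_complete (n := 2) laws) // x_pendant_right.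
Qed.

Lemma x_two_left_01_bot m : x m.+4 [:: 2; 3]%N 0 =
  c 1%N * (c 2%N * c m.+1 + (pend m.+2 - c 2%N * c m.+1) / qn m.+1).
Proof.
rewrite x_two_left_b0 // x_two_row0 // qnum1.
by rewrite mul1r [_^-1 * _]mulrC.
Qed.

(* The last clique vertex and the right vertex exchange their roles: the clique
   then becomes the [m + 2] vertices on the right. *)
Lemma x_two_left_01_top m : x m.+4.+1 [:: 2; 3]%N m.+1 =
  pend 2 * c m.+2 + qn m.+1 / qn m.+2 *
    (c 2%N * c m.+3 + (pend m.+4 - c 2%N * c m.+3) / qn m.+3 - pend 2 * c m.+2).
Proof.
rewrite (x_expand laws (j := 1) (b' := m.+4.+1)) /=; try lia.
have lin : qlinear q (fun k => x m.+4.+1 [:: 2; 3; k]%N m.+4.+1) 3 m.+4.+1.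
  by apply: (x_entry laws (s1 := [:: 2; 3]%N) (s2 := [::])) => //=; lia.
have := @qlinear_interp _ 3 m.+1 m.+1 lin (leqnSn _); rewrite !add3n => -> /=.
rewrite (x_absorb_full laws (s := [:: 2; 3]%N)) /=; last by lia.
rewrite x_two_row0 // qnum1 mul1r [_^-1 * (pend _ - _)]mulrC.
rewrite (@x_full _ _ _ m.+1) /=; try lia.
rewrite (x_split laws (t := 3) (m := m.+2)) //=.
rewrite (x_absorb_full laws (n := 3) (s := [:: 2; 3]%N)) //=.
rewrite (x_absorb_full laws (n := 3) (s := [:: 2]%N)) //= x_pend.
by rewrite (x_complete (n := m.+2) laws).
Qed.

Lemma x_two_left_01 m b : (b <= m.+1)%N -> x m.+4.+1 [:: 2; 3]%N b =
  x m.+4.+1 [:: 2; 3]%N 0 +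
    qn b / qn m.+1 * (x m.+4.+1 [:: 2; 3]%N m.+1 - x m.+4.+1 [:: 2; 3]%N 0).
Proof.
move=> bm; have lin : qlinear q (x m.+4.+1 [:: 2; 3]%N) 0 m.+1.
  by apply: (x_last laws) => //=; lia.
by have := @qlinear_interp _ 0 m b lin bm; rewrite !add0n.
Qed.

(* Two cliques, of sizes 4 and [m + 3], sharing one vertex. *)
Lemma x_K4 m : x m.+4.+2 [:: 4; 4; 4]%N m.+4.+2 =
  let t0 := c 3%N * c m.+3 in let A := c 2%N * c m.+4 in
  t0 + qn 3 / qn m.+3 * (A + (pend m.+4.+1 - A) / qn m.+4 * (1 + q) - t0).
Proof.
have t0E : x m.+4.+2 [:: 3; 3; 3]%N m.+4.+2 = c 3%N * c m.+3.
  rewrite (@x_full _ _ _ m.+2) /=; try lia.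
  rewrite (x_split laws (t := 3) (m := m.+3)) //=.
  by rewrite (x_complete (n := 3) laws) // (x_complete (n := m.+3) laws).
have t1E : x m.+4.+2 [:: 3; 3; 4]%N m.+4.+2 = c 3%N * c m.+3 + 1 / qn m.+3 *
    (c 2%N * c m.+4 + (pend m.+4.+1 - c 2%N * c m.+4) / qn m.+4 * (1 + q) - c 3%N * c m.+3).
  have lin : qlinear q (fun k => x m.+4.+2 [:: 3; 3; k]%N m.+4.+2) 3 m.+4.+2.
    by apply: (x_entry laws (s1 := [:: 3; 3]%N) (s2 := [::])) => //=; lia.
  have := @qlinear_interp _ 3 m.+2 1 lin isT; rewrite !add3n => -> /=.
  rewrite t0E qnum1 (x_absorb_full laws (s := [:: 3; 3]%N)) /=; last by lia.
  by rewrite x_two_val //= qnum1 qnum0 mulr1 mulr0 addr0.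
(* Two diagonal relations lead from the entries 3, 3, 4 through 3, 4, 4 to 4, 4, 4. *)
have := x_diag laws (n := m.+4.+2) (s1 := [:: 3]%N) [::] m.+4.+2 (u := 3) isT isT.
have := x_diag laws (n := m.+4.+2) (s1 := [::]) [:: 4]%N m.+4.+2 (u := 3) isT isT.
rewrite /= t0E t1E => e3 e2.
move: e2 e3; set X2 := x m.+4.+2 [:: 3; 4; 4]%N _; set X3 := x _ _ _.
set T0 := c 3%N * c m.+3; set T1 := (T0 + _ / _ * _) => e2 e3.
have -> : X3 = (1 + q) * X2 - q * T1 by rewrite e3; ring.
have -> : X2 = (1 + q) * T1 - q * T0 by rewrite e2; ring.
by rewrite /T1 !qnumS qnum0; field; rewrite -!qnumS !qnum_neq0.
Qed.

(** For this [b] the last vertex misses exactly the clique vertices 2 and 3, which thus form a pair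
    on the left of a clique of size [m + 2]; [A], [B], [C] are the corners of this pair family. *)
Lemma x_two_left_22_top m : x m.+4.+2 [:: 4; 4]%N m.+1 =
  let A := c 4%N * c m.+2 in let B := x m.+4.+2 [:: 4; 4; 4]%N m.+4.+2 in
  let C := x m.+4.+2 [:: 4; 4]%N m.+4.+2 in
  A + (B - A) / qn m.+2 * (qn m.+1 * (1 + q))
    + (C - A - (B - A) * (1 + q)) / qn m.+2 * qn m.
Proof.
rewrite (x_expand laws (j := 2) (b' := m.+4.+2)) /=; try lia.
have pf : pair_family m.+2 (fun i j => x m.+4.+2 [:: 4; 4; 4 + i; 4 + j]%N m.+4.+2).
  by apply: (@pair_family_x m.+4.+2 [:: 4; 4]%N m.+4.+2 m.+2) => //=; lia.
have := pair_family_corners pf (i := m.+1) (j := m.+1); rewrite leqnn leqnSn.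
move=> /(_ isT); rewrite !addn0 ![(4 + _)%N]/= => -> /=.
rewrite !(x_absorb_full laws (s := [:: 4; 4; m.+4.+2]%N)) /=; try lia.
rewrite !(x_absorb_full laws (s := [:: 4; 4; 4]%N)) /=; try lia.
rewrite !(x_absorb_full laws (s := [:: 4; 4]%N)) /=; try lia.
have -> : x m.+4.+2 [:: 4; 4; 4; 4]%N m.+4.+2 = c 4%N * c m.+2.
  rewrite (@x_full _ _ _ m.+1) /=; try lia.
  rewrite (x_split laws (t := 4) (m := m.+2)) //=.
  by rewrite (x_complete (n := 4) laws) // (x_complete (n := m.+2) laws).
by field; rewrite !qnum_neq0.
Qed.

Lemma x_two_left_22 m b : (b <= m.+1)%N -> x m.+4.+2 [:: 4; 4]%N b =
  x m.+4.+2 [:: 4; 4]%N 0 +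
    qn b / qn m.+1 * (x m.+4.+2 [:: 4; 4]%N m.+1 - x m.+4.+2 [:: 4; 4]%N 0).
Proof.
move=> bm; have lin : qlinear q (x m.+4.+2 [:: 4; 4]%N) 0 m.+1.
  by apply: (x_last laws) => //=; lia.
by have := @qlinear_interp _ 0 m b lin bm; rewrite !add0n.
Qed.

(** Interpolation, cleared of denominators, between [g = 0], where the intervals of the second and
    the last vertex partition the clique, and [g = b], where the second vertex belongs to the
    clique. *)
Lemma x_two_left_interp a g b p : (p <= a)%N -> (g <= b)%N ->
  qn b * x (a + b).+3 [:: p.+2; (a + g).+2] b =
  q ^+ g * qn (b - g) * x (a + b).+3 [:: p.+2; a.+2] b + qn g * x (a + b).+3 [:: p.+2] b.
Proof.
move=> pa gb; have lin : qlinear q (fun k => x (a + b).+3 [:: p.+2; k] b) a.+2 (a + b).+2.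
  by apply: (x_entry laws (s1 := [:: p.+2]) (s2 := [::])) => //=; lia.
have := qlinear_slope (k := b) lin; rewrite !addSn leqnn => /(_ isT).
have := qlinear_slope (k := g) lin; rewrite !addSn => -> /=; last by lia.
have := x_absorb_last laws (n := (a + b).+3) (s := [:: p.+2]) (b := b) => /= -> //.
  by move=> ->; rewrite qnum_sub //; ring.
by lia.
Qed.

Lemma x_one_left_interp r be t : (t <= r)%N ->
  qn r * x (r + be).+2 [:: r.+1] (be + t)%N =
  q ^+ t * qn (r - t) * x (r + be).+2 [:: r.+1] be +
    qn t * x (r + be).+2 [:: r.+1] (be + r)%N.
Proof.
move=> tr; have lin : qlinear q (x (r + be).+2 [:: r.+1]) be (be + r).
  by apply: (x_last laws) => //=; lia.
rewrite (qlinear_slope lin) ?leq_add2l // (qlinear_slope lin (leqnn _)).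
by rewrite qnum_sub //; ring.
Qed.
End Solve.

(** * Expansions in elementary symmetric functions *)

Section Elementary.
Variables (K : fieldType) (q : K).
Local Notation qn := (qnum q).
Hypothesis qnum_neq0 : forall k, qn k.+1 != 0.
Variables (x : nat -> seq nat -> nat -> K) (e : nat -> K).
Local Notation c := (fun k => qfact q k * e k).
Hypothesis laws : clique_path_laws q x c.

Lemma q2_neq0 : 1 + q != 0.
Proof. by have := qnum_neq0 1; rewrite !qnumS qnum0 mulr0 addr0 mulr1. Qed.

(** The formula [x_ends] after substitution of the clique values; the factor [qfact q m] is common
    to all of them. *)
Lemma ends_elementary m r b : (r + b <= m.+2)%N -> x m.+4 [:: r.+1] b = qfact q m *
  (qn m.+1 * (qn m.+2 - qn r - qn b - (q - 1) * qn r * qn b) * (e 1%N * e 1%N * e m.+2)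
   + (qn m.+3 * qn m.+1 * (qn r + qn b) - qn r * qn b * (qn m.+1 + qn m.+3))
     * (e 1%N * e m.+3)
   + qn r * qn b * (1 + (q - 1) * qn m.+1) * (1 + q) * (e 2%N * e m.+2)
   + qn r * qn b * qn m.+1 * qn m.+4 * e m.+4).
Proof.
move=> rb; rewrite (x_ends qnum_neq0 laws rb) /= /pend !qfactS qfact0.
rewrite !qnumS qnum0.
set R := qn r; set B := qn b; set u := qn m; set f := qfact q m.
by field; rewrite -!qnumS !qnum_neq0.
Qed.

(* The coefficient of [qn j + q * qn i] in [pair_family_affine]. *)
Lemma beta_elementary m b : (b <= m.+1)%N ->
  x m.+4.+1 [:: 2; 3]%N b - x m.+4.+1 [:: 2; 2]%N b = qfact q m *
  (q * qn m.+2 * (qn m.+1 - qn b) * (e 1%N * e 1%N * e m.+3)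
   + ((1 + q) * (qn b - qn m.+1) - (1 + (q - 1) * qn m.+1) * qn b) * (e 1%N * e 2%N * e m.+2)
   + (qn m.+1 * qn m.+4 + qn b * (q ^+ 2 * qn m * qn m.+3 - 1)) * (e 1%N * e m.+4)
   - qn m.+1 * (1 + q) * qn b * (e 2%N * e m.+3)
   + (1 + (q - 1) * qn m.+1) * (1 + q + q ^+ 2) * qn b * (e 3%N * e m.+2)
   + qn m.+1 * qn m.+4.+1 * qn b * e m.+4.+1).
Proof.
move=> bm; rewrite (x_two_left_01 qnum_neq0 laws bm) (x_two_left_01_top qnum_neq0 laws).
rewrite (x_two_left_01_bot qnum_neq0 laws) (x_two_left_00 qnum_neq0 laws) /= ?(leqW bm) //.
rewrite /pend !qfactS qfact0 !qnumS qnum0.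
set B := qn b; set u := qn m; set f := qfact q m.
by field; rewrite q2_neq0 -!qnumS !qnum_neq0.
Qed.

(* The coefficient of [qn i * qn j.-1] in [pair_family_affine]; it is obtained
   from [i = j = 2], where the graph with [b = m + 1] is a pair family again. *)
Lemma delta_elementary m b : (b <= m.+1)%N ->
  x m.+4.+2 [:: 3; 4]%N b - x m.+4.+2 [:: 2; 2]%N b -
    (x m.+4.+2 [:: 2; 3]%N b - x m.+4.+2 [:: 2; 2]%N b) * (1 + q + q) =
  qfact q m *
  (- q * (1 + q) * qn m.+3 * qn m.+1 * (1 + (q - 1) * qn b) * (e 1%N * e 1%N * e m.+4)
   + q * (1 + q) * qn m.+1 * (1 + (q - 1) * qn b) * (e 1%N * e 2%N * e m.+3)
   + qn m.+1 * (q ^+ 2 * qn m.+2 * qn m.+4.+1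
        - q * qn b * (qn m.+4.+2 + q * qn m.+4 + q * qn m.+2)) * (e 1%N * e m.+4.+1)
   + q * (1 + q) * qn b * qn m.+2 *
        (1 + (1 + (q - 1) * qn m.+2) + (1 + (q - 1) * qn m.+3)) * (e 2%N * e m.+4)
   - (1 + (q - 1) * qn m.+2) * (1 + q) * (1 + q + q ^+ 2) * qn b * (e 3%N * e m.+3)
   + q ^+ 2 * qn m.+1 * qn m.+2 * qn m.+4.+2 * qn b * e m.+4.+2).
Proof.
move=> bm.
have pf : pair_family q (m.+3 - b) (fun i j => x m.+4.+2 [:: i.+2; j.+2] b).
  by apply: (pair_family_two_left laws); lia.
(* Here the unknown has the coefficient [qn 2 * qn 1 = 1 + q], which is invertible. *)
have e22 := pair_family_affine pf (i := 2) (j := 2); rewrite /= in e22.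
have {e22} e12 : x m.+4.+2 [:: 3; 4]%N b - x m.+4.+2 [:: 2; 2]%N b -
    (x m.+4.+2 [:: 2; 3]%N b - x m.+4.+2 [:: 2; 2]%N b) * (1 + q + q) =
    (x m.+4.+2 [:: 4; 4]%N b - x m.+4.+2 [:: 2; 2]%N b) / (1 + q)
    - (x m.+4.+2 [:: 2; 3]%N b - x m.+4.+2 [:: 2; 2]%N b) * (1 + q).
  rewrite e22 ?leqnn /=; last by lia.
  by rewrite !qnumS qnum0; field; rewrite q2_neq0.
rewrite {}e12 (beta_elementary (m := m.+1)) ?(leqW bm) //.
rewrite (x_two_left_22 qnum_neq0 laws bm) (x_two_left_22_top qnum_neq0 laws) (x_K4 qnum_neq0 laws).
rewrite (x_two_left_b0 laws (m := m.+3) (i := 2) (j := 2)) // (x_two_left_00 qnum_neq0 laws); last by lia.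
rewrite !(x_two_val qnum_neq0 laws (i := 2) (j := 2)) //=.
rewrite /pend !qfactS qfact0 !qnumS qnum0.
set B := qn b; set u := qn m; set f := qfact q m.
by field; rewrite q2_neq0 -!qnumS !qnum_neq0.
Qed.

(* The constant coefficient in [pair_family_affine]. *)
Lemma alpha_elementary m b : (b <= m.+1)%N -> x m.+4 [:: 2; 2]%N b =
  qfact q m * ((1 + q) * (qn m.+1 - qn b) * (e 1%N * e 2%N * e m.+1)
    + (1 + q) * qn m.+2 * qn b * (e 2%N * e m.+2)).
Proof.
move=> bm; rewrite (x_two_left_00 qnum_neq0 laws) // !qfactS qfact0 !qnumS qnum0.
by field; rewrite -!qnumS !qnum_neq0.
Qed.

(** The formula of [pair_family_affine], rearranged into sums of products of q-numbers and powers of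
    [q]. The clique has size [a.+1 + b.+1], so [r <= a.+1] keeps the two attaching intervals
    disjoint. *)
Lemma x_two_left_low m p r a b :
  (0 < p <= r)%N -> (r <= a.+1)%N -> (p <= a)%N -> (m.+1 = a + b)%N ->
  let U := qn p * (q ^+ r * qn (a.+1 - r)) + qn r.-1 * (q ^+ p * qn (a - p))
     + q ^+ r.-1 * qn a in
  x m.+4.+2 [:: p.+2; r.+2] b.+1 = qfact q m * (
    qn m.+2 * qn m.+1 * qn m.+4.+2 * qn b.+1 * qn r * qn p.+1 * e m.+4.+2
  + qn m.+1 * (q * qn b.+1 * qn m.+4.+1 * U
      + qn m.+2 * (q ^+ b.+1 * qn (m.+4.+1 - b.+1)) * qn r * qn p.+1
      + q ^+ a.+1 * qn b.+1 * qn b * qn m.+4.+1 * (qn r + q * qn p)) * (e 1%N * e m.+4.+1)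
  + qn m.+2 * (1 + q) * qn b.+1 * ((q ^+ r * qn (m.+2 - r)) * (q ^+ p * qn (m.+1 - p))
      + q ^+ m.+2 * (1 + q) * qn m.+1 + q ^+ m.+3 * (1 + q) * qn p * qn r.-1) * (e 2%N * e m.+4)
  + q ^+ m.+2 * (1 + q + q ^+ 2) * qn b.+1 * (qn p * (q ^+ r * qn (m.+2 - r))
      + qn r.-1 * (q ^+ p * qn (m.+1 - p)) + q ^+ r.-1 * qn m.+1) * (e 3%N * e m.+3)
  + qn m.+3 * qn m.+1 * q ^+ b.+2 * U * (e 1%N * e 1%N * e m.+4)
  + qn m.+1 * q ^+ b.+1 * ((1 + q) * (q ^+ r * qn (a.+1 - r)) * (q ^+ p * qn (a - p))
      + q ^+ a * qn b.+1 * (q ^+ r * qn (a.+1 - r) + q * (q ^+ p * qn (a.+1 - p))))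
    * (e 1%N * e 2%N * e m.+3)).
Proof.
move=> /andP[p0 pr] ra pa mab /=.
have bm : (b.+1 <= m.+1)%N by lia.
have pf : pair_family q (m.+3 - b.+1) (fun i j => x m.+4.+2 [:: i.+2; j.+2] b.+1).
  by apply: (pair_family_two_left laws); lia.
rewrite (pair_family_affine pf (i := p) (j := r)); last by lia.
rewrite delta_elementary // (beta_elementary (m := m.+1)) ?(leqW bm) //.
rewrite (alpha_elementary (m := m.+2)); last by lia.
rewrite !qnum_sub; try lia.
case: r p0 pr ra pf => [|r] p0 pr ra pf; first by lia.
rewrite /= !expr_qnum !qfactS.
(* All q-numbers are expanded over those of [a], [b], [p] and [r], which leaves a polynomial
   identity. *)
rewrite ![qn m.+4.+2]qnumS ![qn m.+4.+1]qnumS ![qn m.+4]qnumS ![qn m.+3]qnumS.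
rewrite ![qn m.+2]qnumS mab qnumD ![qn a.+1]qnumS ![qn b.+2]qnumS ![qn b.+1]qnumS
  ![qn r.+1]qnumS ![qn p.+1]qnumS ![qn 2]qnumS ![qn 1]qnumS qnum0.
set f := qfact q m; set A := qn a; set B := qn b; set P := qn p; set R := qn r.
by ring.
Qed.

Lemma x_two_left_low0 m p r : (0 < p <= r)%N -> (r <= m.+2)%N -> (p <= m.+1)%N ->
  let U := qn p * (q ^+ r * qn (m.+2 - r)) + qn r.-1 * (q ^+ p * qn (m.+1 - p))
     + q ^+ r.-1 * qn m.+1 in
  x m.+4.+1 [:: p.+2; r.+2] 0 = qfact q m * (
    qn m.+1 * qn m.+4 * qn r * qn p.+1 * (e 1%N * e m.+4)
  + qn m.+2 * q * U * (e 1%N * e 1%N * e m.+3)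
  + (1 + q) * (q ^+ r * qn (m.+2 - r)) * (q ^+ p * qn (m.+1 - p))
     * (e 1%N * e 2%N * e m.+2)).
Proof.
move=> /andP[p0 pr] rm pm /=; rewrite (x_two_left_b0 laws) ?pr //.
rewrite (x_two_val qnum_neq0 laws) ?pr //= !qnum_sub //.
case: r p0 pr rm => [|r] p0 pr rm; first by lia.
rewrite /= /pend !expr_qnum !qfactS qfact0 !qnumS qnum0.
by field; rewrite -!qnumS !qnum_neq0.
Qed.

(* [tail]: the first vertex is only joined to the second one ([p = 0]). *)
Lemma x_tail_low0 m r : (r <= m.+1)%N ->
  x m.+4 [:: 2%N; r.+2] 0 = qfact q m * (
    qn m.+3 * qn r * (e 1%N * e m.+3)
  + q * qn m.+1 * qn r * (e 1%N * e 1%N * e m.+2)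
  + (1 + q) * (q ^+ r * qn (m.+1 - r)) * (e 1%N * e 2%N * e m.+1)).
Proof.
move=> rm; rewrite (x_two_left_b0 laws) ?rm // (x_two_row0 qnum_neq0 laws) // !qnum_sub //.
rewrite /pend !qfactS qfact0 !qnumS qnum0.
by field; rewrite -!qnumS !qnum_neq0.
Qed.

Lemma x_tail_low m r a b : (r <= a.+1)%N -> (m = a + b)%N ->
  x m.+4.+1 [:: 2%N; r.+2] b.+1 = qfact q m * (
    qn m.+1 * qn m.+4.+1 * qn b.+1 * qn r * e m.+4.+1
  + qn r * (q * qn b.+1 * qn m.+4 * qn a
      + qn m.+1 * (q ^+ b.+1 * qn (m.+4 - b.+1))
      + q ^+ a.+1 * qn b.+1 * qn b * qn m.+4) * (e 1%N * e m.+4)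
  + qn m.+1 * (1 + q) * qn b.+1 * (q ^+ r * qn (m.+3 - r)) * (e 2%N * e m.+3)
  + q ^+ m.+1 * (1 + q + q ^+ 2) * qn b.+1 * qn r * (e 3%N * e m.+2)
  + qn m.+2 * q ^+ b.+2 * qn a * qn r * (e 1%N * e 1%N * e m.+3)
  + q ^+ b.+1 * ((1 + q) * (q ^+ r * qn (a.+1 - r)) * qn a
      + q ^+ a * qn b.+1 * (q ^+ r * qn (a.+1 - r) + q * qn a.+1))
    * (e 1%N * e 2%N * e m.+2)).
Proof.
move=> ra mab.
have bm : (b.+1 <= m.+1)%N by lia.
have pf : pair_family q (m.+2 - b.+1) (fun i j => x m.+4.+1 [:: i.+2; j.+2] b.+1).
  by apply: (pair_family_two_left laws); lia.
rewrite (pair_family_affine pf (i := 0) (j := r)); last by lia.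
rewrite beta_elementary // (alpha_elementary (m := m.+1)); last by lia.
rewrite !qnum_sub; try lia.
rewrite /= !expr_qnum !qfactS.
rewrite ![qn m.+4.+1]qnumS ![qn m.+4]qnumS ![qn m.+3]qnumS.
rewrite ![qn m.+2]qnumS ![qn m.+1]qnumS mab qnumD ![qn a.+1]qnumS ![qn b.+2]qnumS
  ![qn b.+1]qnumS ![qn 2]qnumS ![qn 1]qnumS qnum0.
by ring.
Qed.

(** Past the boundary, [x_two_left_interp] combines [x_two_left_low] at [r = a.+1] with
    [ends_elementary]. *)
Lemma x_two_left_high m p a g b :
  (0 < p <= a)%N -> (g <= b.+1)%N -> (m.+1 = a + b)%N ->
  let H := q ^+ g * qn (b.+1 - g) in
  x m.+4.+2 [:: p.+2; (a + g).+3] b.+1 = qfact q m * (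
    qn p.+1 * qn m.+2 * qn m.+1 * qn m.+4.+2 * qn (a + g).+1 * qn b.+1 * e m.+4.+2
  + qn m.+1 * (qn m.+2 * (q ^+ b.+1 * qn (m.+4.+1 - b.+1)) * qn p.+1 * qn (a + g).+1
      + H * (q * qn m.+4.+1 * qn a * (q ^+ p * qn (a.+1 - p))
           + q ^+ a.+1 * qn b * qn m.+4.+1 * (qn a.+1 + q * qn p))
      + qn g * qn m.+2 * q * qn m.+4.+1 * (q ^+ p * qn (m.+2 - p))) * (e 1%N * e m.+4.+1)
  + (H * qn m.+2 * (1 + q) * (q ^+ a.+1 * qn b * (q ^+ p * qn (m.+1 - p))
      + q ^+ m.+2 * (1 + q) * qn m.+1 + q ^+ m.+3 * (1 + q) * qn p * qn a)
      + qn g * qn p.+1 * q ^+ m.+3 * (1 + q) * qn m.+2 * qn m.+1) * (e 2%N * e m.+4)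
  + H * q ^+ m.+2 * (1 + q + q ^+ 2) * (q ^+ a.+1 * qn p * qn b
      + qn a * (q ^+ p * qn (m.+1 - p)) + q ^+ a * qn m.+1) * (e 3%N * e m.+3)
  + qn m.+3 * qn m.+1 * q ^+ b.+2 * (q ^+ p * qn (a.+1 - p)) * qn (a + g)
      * (e 1%N * e 1%N * e m.+4)
  + H * qn m.+1 * q ^+ b.+1 * q ^+ a * q * (q ^+ p * qn (a.+1 - p))
      * (e 1%N * e 2%N * e m.+3)).
Proof.
move=> /andP[p0 pa] gb mab /=; apply: (mulfI (qnum_neq0 b)).
have := x_two_left_interp laws (a := a.+1) (leqW pa) gb.
have -> : (a.+1 + b.+1 = m.+3)%N by lia.
rewrite addSn => ->; rewrite (x_two_left_low (a := a)) ?leqnn ?p0 ?(leqW pa) //.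
rewrite (ends_elementary (m := m.+2)); last by lia.
rewrite !qnum_sub; try lia.
rewrite /= !expr_qnum !qfactS ![qn (a + g).+1]qnumS [qn (a + g)]qnumD.
rewrite ![qn m.+4.+2]qnumS ![qn m.+4.+1]qnumS ![qn m.+4]qnumS ![qn m.+3]qnumS.
rewrite ![qn m.+2]qnumS mab qnumD ![qn a.+1]qnumS ![qn b.+2]qnumS ![qn b.+1]qnumS
  ![qn p.+1]qnumS ![qn 2]qnumS ![qn 1]qnumS qnum0.
by ring.
Qed.

Lemma x_tail_high m a g b : (g <= b.+1)%N -> (m = a + b)%N ->
  let H := q ^+ g * qn (b.+1 - g) in
  x m.+4.+1 [:: 2%N; (a + g).+3] b.+1 = qfact q m * (
    qn m.+1 * qn m.+4.+1 * qn (a + g).+1 * qn b.+1 * e m.+4.+1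
  + (qn m.+1 * (q ^+ b.+1 * qn (m.+4 - b.+1)) * qn (a + g).+1
      + H * (q * qn m.+4 * qn a * qn a.+1 + q ^+ a.+1 * qn b * qn m.+4 * qn a.+1)
      + qn g * qn m.+1 * q * qn m.+4 * qn m.+1) * (e 1%N * e m.+4)
  + (H * qn m.+1 * (1 + q) * q ^+ a.+1 * qn b.+2
      + qn g * q ^+ m.+2 * (1 + q) * qn m.+1) * (e 2%N * e m.+3)
  + H * q ^+ m.+1 * (1 + q + q ^+ 2) * qn a.+1 * (e 3%N * e m.+2)
  + qn m.+2 * q ^+ b.+2 * qn a.+1 * qn (a + g) * (e 1%N * e 1%N * e m.+3)
  + H * q ^+ b.+1 * q ^+ a * q * qn a.+1 * (e 1%N * e 2%N * e m.+2)).
Proof.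
move=> gb mab /=; apply: (mulfI (qnum_neq0 b)).
have := x_two_left_interp laws (a := a.+1) (leq0n _) gb.
have -> : (a.+1 + b.+1 = m.+2)%N by lia.
rewrite addSn => ->; rewrite (x_tail_low (a := a)) ?leqnn //.
rewrite (ends_elementary (m := m.+1) (r := 1)); last by lia.
rewrite !qnum_sub; try lia.
rewrite /= !expr_qnum !qfactS ![qn (a + g).+1]qnumS [qn (a + g)]qnumD.
rewrite ![qn m.+4.+1]qnumS ![qn m.+4]qnumS ![qn m.+3]qnumS.
rewrite ![qn m.+2]qnumS ![qn m.+1]qnumS mab qnumD ![qn a.+1]qnumS ![qn b.+2]qnumS
  ![qn b.+1]qnumS ![qn 2]qnumS ![qn 1]qnumS qnum0.
by ring.
Qed.

Lemma x_one_left_full m b : (b <= m)%N -> x m.+2 [:: m.+1] b = qfact q m *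
  ((q ^+ b * qn (m.+1 - b)) * (e 1%N * e m.+1) + qn b * qn m.+2 * e m.+2).
Proof.
move=> bm; have := x_absorb_last laws (n := m.+2) (s := [::]) (b := b) => /= ->.
  rewrite (x_pendant_right qnum_neq0 laws) ?leqW // qnum_sub ?leqW // !qfactS qfact0.
  by rewrite !qnumS qnum0; field; rewrite -!qnumS !qnum_neq0.
by lia.
Qed.

Lemma x_one_left_isolated m : x m.+2 [:: 1%N] m = qfact q m.+1 * (e 1%N * e m.+1).
Proof.
rewrite (x_full laws (b' := m.+2)) /=; try lia.
rewrite (x_pendant_left qnum_neq0 laws) // qnum0 /= !qfactS qfact0 qnum1.
by ring.
Qed.

(** Interpolation between [t = 0], where the two intervals partition the clique, and [t = r.+1],
    where the last vertex belongs to the clique. *)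
Lemma x_one_left_high m r be t : (t <= r.+1)%N -> (m = r + be)%N ->
  let H := q ^+ t * qn (r.+1 - t) in
  x m.+4 [:: r.+2] (be.+1 + t)%N = qfact q m * (
    (H * q ^+ be.+1 * qn m.+1 * qn r.+2
      + q ^+ r.+1 * (qn m.+3 * qn be.+1 * qn be + q ^+ be * qn t * qn m.+3 * qn be.+1
          + q ^+ be.+1 * qn t * qn m.+1)) * (e 1%N * e m.+3)
  + H * qn be.+1 * q ^+ m.+1 * (1 + q) * (e 2%N * e m.+2)
  + qn m.+1 * qn m.+4 * (qn t * qn m.+2 + H * qn be.+1) * e m.+4).
Proof.
move=> tr mrb /=; apply: (mulfI (qnum_neq0 r)).
have := x_one_left_interp laws (r := r.+1) be.+1 tr.
have [-> ->] : (r.+1 + be.+1 = m.+2)%N /\ (be.+1 + r.+1 = m.+2)%N by lia.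
move=> ->; rewrite (ends_elementary (m := m)); last by lia.
rewrite (x_full laws (n := m.+4) (b' := m.+4)) /=; try lia.
rewrite (x_pendant_left qnum_neq0 laws); last by lia.
rewrite !qnum_sub; try lia.
rewrite !expr_qnum !qfactS qfact0.
rewrite ![qn m.+4]qnumS ![qn m.+3]qnumS.
rewrite ![qn m.+2]qnumS ![qn m.+1]qnumS.
(* The nonvanishing fact is rewritten along with the goal, so that [field] recognises its
   denominator. *)
have nz := qnum_neq0 m.+2; rewrite !qnumS in nz.
rewrite mrb qnumD in nz *.
rewrite ![qn r.+2]qnumS ![qn r.+1]qnumS ![qn be.+1]qnumS qnum1.
by field.
Qed.
End Elementary.

(** * Positivity *)

Lemma XG_first N n k b : (b <= n)%N ->
  XG N n.+2 [:: 1%N; k.+1] b = cl N 1 * XG N n.+1 [:: k] b.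
Proof.
move=> bn; rewrite /XG -add1n csf_hess_split => [|[|i] //].
congr (_ * _); first by rewrite /cl -csf_complete; apply: csf_ext => i j; lia.
apply: csf_hess_ext => -[|i] ilt; rewrite /clique_path /=; first by lia.
rewrite !nth_nil; case: (ltnP _ (n.+1 - b)) => h1; case: (ltnP _ (n - b)) => h2.
all: by move: ilt bn h1 h2; clear; rewrite ?add1n ?addSn; lia.
Qed.

(** * Families with positive expansions, in the fraction field *)

Local Notation K N := {fraction {mpoly {poly int}[N]}}.

Definition const_frac N (p : {poly int}) : K N := tofrac (p%:MP_[N]).
Definition qfrac N : K N := tofrac (qvar N).
Definition efrac N (k : nat) : K N := tofrac (mesym N {poly int} k).

Lemma rmorph_qnum (S T : pzRingType) (f : {rmorphism S -> T}) t k :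
  f (qnum t k) = qnum (f t) k.
Proof. by rewrite rmorph_sum; apply: eq_bigr => i _; rewrite rmorphXn. Qed.

Lemma rmorph_qfact (S T : pzRingType) (f : {rmorphism S -> T}) t k :
  f (qfact t k) = qfact (f t) k.
Proof. by rewrite rmorph_prod; apply: eq_bigr => i _; rewrite rmorph_qnum. Qed.

Lemma qnum_frac_neq0 N k : qnum (qfrac N) k.+1 != 0.
Proof.
rewrite -rmorph_qnum tofrac_eq0 /qvar -rmorph_qnum mpolyC_eq0.
apply/eqP => /(congr1 (fun p : {poly int} => p`_0)).
by rewrite qnumS coefD coef1 coefXM coef0 addr0.
Qed.

Lemma clique_path_laws_frac N :
  clique_path_laws (qfrac N) (fun n s b => tofrac (XG N n s b))
    (fun k => qfact (qfrac N) k * efrac N k).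
Proof.
have clE k : tofrac (cl N k) = qfact (qfrac N) k * efrac N k.
  by rewrite rmorphM rmorph_qfact.
have qlin f lo hi : qlinear (qvar N) f lo hi ->
    qlinear (qfrac N) (fun k => tofrac (f k)) lo hi.
  move=> lin k lok khi; have := congr1 (@tofrac _) (lin k lok khi).
  by rewrite rmorphM !rmorphD rmorph1 rmorphM.
split.
- by move=> n s1 s2 b lo hi *; apply: qlin; apply: XG_qlinear_entry.
- by move=> n s b0 b1 *; apply: (qlin (XG N n s)); apply: XG_qlinear_last.
- move=> n s1 s2 b u su s1_ok; have := congr1 (@tofrac _) (XG_diag N s2 b su s1_ok).
  by rewrite rmorphM !rmorphD rmorph1 rmorphM.
- by move=> t m s b *; rewrite -rmorphM -XG_split.
- by move=> n s b s_ok ?; rewrite (XG_complete _ s_ok) // clE.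
- by move=> n s *; rewrite -clE -rmorphM -XG_last.
- by move=> n s b ?; rewrite XG_absorb_last.
- by move=> n s b ?; rewrite XG_absorb_full.
by move=> n s j b b' bj bj'; rewrite (XG_expand _ bj bj').
Qed.

Definition emonomials N (l : seq ({poly int} * seq nat)) : K N :=
  \sum_(y <- l) const_frac N y.1 * \prod_(k <- y.2) efrac N k.

(** One list serves for all [N], as the coefficients may not depend on the number of variables. *)
Definition epos (f : forall N, K N) : Prop :=
  exists2 l : seq ({poly int} * seq nat),
    all (fun y => y.1 \is a polyOver Num.nneg) l & forall N, f N = emonomials N l.

Lemma polyOver_nnegP (p : {poly int}) :
  reflect (forall i, 0 <= p`_i) (p \is a polyOver Num.nneg).
Proof. by apply: (iffP polyOverP) => p0 i; have := p0 i; rewrite nnegrE. Qed.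

Lemma polyOver_nneg1 : (1 : {poly int}) \is a polyOver Num.nneg.
Proof. by apply/polyOver_nnegP => i; rewrite coef1 ler0n. Qed.

Lemma epos_const (p : {poly int}) : p \is a polyOver Num.nneg ->
  epos (fun N => const_frac N p).
Proof.
move=> p0; exists [:: (p, [::])] => [|N]; first by rewrite /= p0.
by rewrite /emonomials big_seq1 big_nil mulr1.
Qed.

Lemma epos1 : epos (fun N => 1).
Proof.
have := epos_const polyOver_nneg1.
by case=> l l0 lE; exists l => // N; rewrite -lE /const_frac !rmorph1.
Qed.

Lemma epos_q : epos (fun N => qfrac N).
Proof. by apply: epos_const; apply/polyOver_nnegP => i; rewrite coefX ler0n. Qed.

Lemma epos_e k : epos (fun N => efrac N k).
Proof.
exists [:: (1, [:: k])] => [|N]; first by rewrite /= polyOver_nneg1.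
by rewrite /emonomials !big_seq1 /= /const_frac !rmorph1 mul1r.
Qed.

Lemma eposD f g : epos f -> epos g -> epos (fun N => f N + g N).
Proof.
move=> [l l0 lE] [k k0 kE]; exists (l ++ k) => [|N]; first by rewrite all_cat l0.
by rewrite /emonomials big_cat -!/(emonomials _ _) lE kE.
Qed.

Lemma eposM f g : epos f -> epos g -> epos (fun N => f N * g N).
Proof.
move=> [l /allP l0 lE] [k /allP k0 kE].
exists [seq (y.1 * z.1, y.2 ++ z.2) | y <- l, z <- k] => [|N]; last first.
  rewrite lE kE /emonomials big_allpairs_dep mulr_suml; apply: eq_bigr => y _.
  rewrite mulr_sumr; apply: eq_bigr => z _ /=.
  by rewrite big_cat /const_frac !rmorphM /= mulrACA.
apply/allP => _ /allpairsP[[y z] [/= yl zk ->]]; apply/polyOver_nnegP => i.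
rewrite coefM sumr_ge0 // => j _; rewrite mulr_ge0 //.
  by apply/polyOver_nnegP/l0.
by apply/polyOver_nnegP/k0.
Qed.

Lemma eposX f k : epos f -> epos (fun N => f N ^+ k).
Proof.
move=> f0; elim: k => [|k [l l0 lE]]; first exact: epos1.
have [l' l'0 l'E] := eposM f0 (ex_intro2 _ _ l l0 lE).
by exists l' => // N; rewrite exprS l'E.
Qed.

Lemma epos_qnum k : epos (fun N => qnum (qfrac N) k).
Proof.
have ex0 : epos (fun N => 0) by exists [::] => // N; rewrite /emonomials big_nil.
elim: k => [|k IH]; first by case: ex0 => l l0 lE; exists l => // N; rewrite qnum0 -lE.
have [l l0 lE] := eposD epos1 (eposM epos_q IH).
by exists l => // N; rewrite qnumS lE.
Qed.

Lemma epos_qfact k : epos (fun N => qfact (qfrac N) k).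
Proof.
elim: k => [|k IH]; first by case: epos1 => l l0 lE; exists l => // N; rewrite qfact0 -lE.
have [l l0 lE] := eposM (epos_qnum k.+1) IH.
by exists l => // N; rewrite qfactS lE.
Qed.

Lemma epos_ext f g : (forall N, f N = g N) -> epos g -> epos f.
Proof. by move=> fg [l l0 lE]; exists l => // N; rewrite fg. Qed.

(** Positivity is read off the syntax: only sums, products and powers occur, and subtractions stay
    inside natural-number indices. *)
Ltac epos :=
  lazymatch goal with
  | |- epos (fun N => GRing.add (@?f N) (@?g N)) => refine (@eposD f g _ _); epos
  | |- epos (fun N => GRing.mul (@?f N) (@?g N)) => refine (@eposM f g _ _); epos
  | |- epos (fun N => GRing.exp (@?f N) ?k) => refine (@eposX f k _); epos
  | |- epos (fun N => qnum _ ?k) => exact (epos_qnum k)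
  | |- epos (fun N => qfact _ ?k) => exact (epos_qfact k)
  | |- epos (fun N => efrac _ ?k) => exact (epos_e k)
  | |- epos (fun N => qfrac _) => exact epos_q
  | |- epos (fun N => GRing.one _) => exact epos1
  | |- _ => cbv zeta beta; progress cbn beta; epos
  end.

Definition partition_of (s : seq nat) : seq nat := sort geq [seq k <- s | (0 < k)%N].

Lemma partition_ofP s : is_partition (partition_of s).
Proof.
rewrite /is_partition sort_sorted => [|i j]; last by rewrite /geq /= orbC leq_total.
by rewrite all_sort; apply/allP => k; rewrite mem_filter => /andP[].
Qed.

Lemma esym_partition_of s N : Defs.esym (partition_of s) N = \prod_(k <- s) mesym N {poly int} k.
Proof.
rewrite /Defs.esym (perm_big _ (permEl (perm_sort _ _))) big_filter big_mkcond.
by apply: eq_bigr => -[|k] _ //=; rewrite mesym0E.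
Qed.

(** The identity descends from fractions because [tofrac] is injective; terms with the same
    partition are then collected. *)
Lemma e_positive_of_epos (F : symfun) : epos (fun N => tofrac (F N)) -> e_positive F.
Proof.
move=> [l /allP l0 lE].
pose S := undup [seq partition_of y.2 | y <- l].
exists S, (fun la => \sum_(y <- l | partition_of y.2 == la) y.1); split; first split.
- exact: undup_uniq.
- by apply/allP => la; rewrite mem_undup => /mapP[y _ ->]; apply: partition_ofP.
- move=> N; apply/eqP; rewrite -tofrac_eq lE /emonomials; apply/eqP.
  transitivity (tofrac (\sum_(y <- l) y.1 *: Defs.esym (partition_of y.2) N)).
    rewrite rmorph_sum; apply: eq_bigr => y _ /=.
    rewrite esym_partition_of -mul_mpolyC rmorphM rmorph_prod.
    by [].
  congr tofrac; under [RHS]eq_bigr do rewrite scaler_suml.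
  rewrite (exchange_big_dep predT) //= big_seq [RHS]big_seq; apply: eq_bigr => y yl.
  rewrite (eq_bigl (pred1 (partition_of y.2))) => [|la]; last by rewrite /= eq_sym.
  have yS : partition_of y.2 \in S.
    by rewrite mem_undup; apply: (map_f (fun y => partition_of y.2)).
  by rewrite -big_filter (filter_pred1_uniq (undup_uniq _) yS) big_seq1.
move=> la _; apply/polyOver_nnegP => i; rewrite coef_sum big_seq_cond sumr_ge0 //.
by move=> y /andP[yl _]; apply/polyOver_nnegP/l0.
Qed.

(** * The graphs of the theorem *)

Lemma epos_two_left M p r a b : (0 < a)%N -> (a + b = M)%N -> (p < a)%N ->
  (p <= r <= M)%N -> epos (fun N => tofrac (XG N M.+3 [:: p.+2; r.+2] b)).
Proof.
move=> a0 abM pa /andP[pr rM].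
have nz N := qnum_frac_neq0 N; have laws N := clique_path_laws_frac N.
case: b abM => [|b] abM.
  rewrite addn0 in abM; subst a; case: p pa pr => [|p] pa pr.
    case: M a0 rM pa => // m _ rM _.
    apply: (epos_ext (fun N => x_tail_low0 (nz N) (laws N) rM)); cbv zeta; epos.
  case: M a0 rM pa => [|[|m]] // _ rM pa.
  have pr' : (0 < p.+1 <= r)%N by rewrite pr.
  by apply: (epos_ext (fun N => x_two_left_low0 (nz N) (laws N) pr' rM pa)); cbv zeta; epos.
case: a a0 abM pa => // a _ abM pa.
(* The affine formula covers the first case and the interpolation the second. *)
have [ra|ar] := leqP r a.+1.
  case: p pa pr => [|p] pa pr.
    have -> : M = (a + b).+2 by lia.
    by apply: (epos_ext (fun N => x_tail_low (nz N) (laws N) ra erefl)); cbv zeta; epos.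
  have [m mE ->] : exists2 m, (m.+1 = a + b)%N & M = m.+3 by exists (a + b).-1; lia.
  have pr' : (0 < p.+1 <= r)%N by rewrite pr.
  by apply: (epos_ext (fun N => x_two_left_low (nz N) (laws N) pr' ra pa mE)); cbv zeta; epos.
have [g gb ->] : exists2 g, (g <= b.+1)%N & r = (a + g).+1.
  by exists (r - a.+1)%N; lia.
case: p pa pr => [|p] pa pr.
  have -> : M = (a + b).+2 by lia.
  by apply: (epos_ext (fun N => x_tail_high (nz N) (laws N) gb erefl)); cbv zeta; epos.
have [m mE ->] : exists2 m, (m.+1 = a + b)%N & M = m.+3 by exists (a + b).-1; lia.
have pa' : (0 < p.+1 <= a)%N by [].
by apply: (epos_ext (fun N => x_two_left_high (nz N) (laws N) pa' gb mE)); cbv zeta; epos.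
Qed.

Lemma epos_one_left M r b : (M <= r + b)%N -> (r <= M)%N -> (b <= M)%N ->
  epos (fun N => tofrac (XG N M.+2 [:: r.+1] b)).
Proof.
move=> Mrb rM bM.
have nz N := qnum_frac_neq0 N; have laws N := clique_path_laws_frac N.
have [->|rnM] := eqVneq r M.
  by apply: (epos_ext (fun N => x_one_left_full (nz N) (laws N) bM)); cbv zeta; epos.
case: r Mrb rM rnM => [|r] Mrb rM rnM.
  have -> : b = M by lia.
  by apply: (epos_ext (fun N => x_one_left_isolated (nz N) (laws N) M)); cbv zeta; epos.
have [be MrE] : exists be, M = (r + be).+2 by exists (M - r.+2)%N; lia.
have [t tr ->] : exists2 t, (t <= r.+1)%N & b = (be.+1 + t)%N.
  by exists (b - be.+1)%N; lia.
rewrite MrE.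
by apply: (epos_ext (fun N => x_one_left_high (nz N) (laws N) tr erefl)); cbv zeta; epos.
Qed.

(** For [i < j] the condition $d_j \ge j$ prevents [j] from preceding [i], so incomparability only
    compares [j] with the entry of [i]. *)
Lemma chromatic_qsym_clique_path n d s b N :
  is_dyck_path n d ->
  (forall v, (v < n)%N -> nth n d v = clique_path n s b v) ->
  chromatic_qsym (inc (@dyck_prec n d)) N = XG N n s b.
Proof.
move=> [_ _ _ d_ge] dE.
have irr : irreflexive (inc (@dyck_prec n d)) by move=> i; rewrite /inc /= eqxx.
have sym : symmetric (inc (@dyck_prec n d)).
  by move=> i j; rewrite /inc /= eq_sym; congr (_ && _); rewrite andbC.
apply: chromatic_qsym_csf => // i j ij.
rewrite /inc /dyck_prec /dyck_entry /hess /= -dE //.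
have := d_ge j.+1; rewrite /dyck_entry /= => dj.
have ijn := ltn_ord j; have inj : i != j by rewrite -val_eqE /= ltn_eqF.
rewrite inj /=; move: dj ijn ij; clear; move: (nth n d j) (nth n d i) => x y.
by move=> dj ijn ij; apply/idP/idP; lia.
Qed.

Theorem theorem4p1 (n d1 d2 a b : nat) (d : seq nat)
    (d_shape : d = [:: d1; d2] ++ nseq a n.-1 ++ nseq b n)
    (d_dyck : is_dyck_path n d)
    (d_bounce : bounce_number n d = 3) :
  e_positive (chromatic_qsym (inc (@dyck_prec n d))).
Proof.
have [sz_d sorted_d bounded_d ge_d] := d_dyck.
have nE : n = (a + b).+3.
  by move: sz_d; rewrite d_shape /= size_cat !size_nseq; lia.
have dE v : nth n d v.+2 = if (v < a)%N then n.-1 else n.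
  rewrite d_shape /= nth_cat size_nseq !nth_nseq; case: ltnP => //.
  by case: ifP.
(* The [b] trailing entries [n] belong to the [b] vertices just before the last one. *)
have path_eq v : (v < n)%N -> nth n d v = clique_path n [:: d1; d2] b v.
  case: v => [|[|v]] _; rewrite ?d_shape // -d_shape dE /clique_path /= nth_nil.
  by congr (if _ then _ else _); rewrite nE; apply/idP/idP; lia.
have d12 : (0 < d1 <= d2)%N && (2 <= d2 <= n)%N.
  move: sorted_d bounded_d (ge_d 2); rewrite d_shape /dyck_entry /=.
  by move=> /andP[d12 _] /and3P[d1n d2n _] /(_ ltac:(lia)); lia.
(* The bounce sequence first reaches $n$ at $m_2$; here $m_1$ is [nth n d d1]. *)
have [d1n fd1n ffd1] : [/\ d1 != n, nth n d d1 != n & nth n d (nth n d d1) = n].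
  move: d_bounce; rewrite /bounce_number /bounce_seq.
  have -> : dyck_entry n d 1 = d1 by rewrite /dyck_entry d_shape.
  have -> : traject (fun k => dyck_entry n d k.+1) d1 n =
      [:: d1, nth n d d1, nth n d (nth n d d1)
        & traject (fun k => dyck_entry n d k.+1) (nth n d (nth n d (nth n d d1))) (a + b)].
    by rewrite {2}nE.
  rewrite /=.
  have [-> //|d1n] := eqVneq d1 n; have [-> //|fd1n] := eqVneq (nth n d d1) n.
  have [-> //|ffd1n] := eqVneq (nth n d (nth n d d1)) n.
  (* Length 3 without reaching $n$ would mean that the terms run out, so $n = 3$; a direct check of
     $d_1$ and $d_2$ excludes this. *)
  rewrite /= size_take size_traject => ab0.
  have [a0 b0] : a = 0%N /\ b = 0%N by move: ab0; case: ifP; lia.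
  move: d12 d1n ffd1n; rewrite nE d_shape a0 b0 /=; clear.
  by case: d1 d2 => [|[|[|[|x]]]] [|[|[|[|y]]]].
apply: e_positive_of_epos.
case: (ltnP 1 d1) => d1_gt1.
  have [p pE] : exists p, d1 = p.+2 by exists (d1 - 2)%N; lia.
  (* As $m_1 \ne n$, the interval of the first vertex and that of the last do not cover the clique
     of size [a + b]. *)
  have pa : (p < a)%N by move: fd1n; rewrite pE dE; case: ifP; rewrite ?eqxx.
  have d2n : (d2 <= n.-1)%N.
    have a0 : (0 < a)%N by lia.
    move: sorted_d; rewrite d_shape; case: (a) a0 => // a' _ /=.
    by case/and3P.
  apply: epos_ext => [N|]; first by rewrite (chromatic_qsym_clique_path N d_dyck path_eq).
  rewrite pE nE (_ : d2 = (d2 - 2).+2); last by lia.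
  by apply: (epos_two_left (a := a)); lia.
have d1E : d1 = 1%N by lia.
have d2E : nth n d 1 = d2 by rewrite d_shape.
rewrite d1E d2E in fd1n ffd1.
have [r rE] : exists r, d2 = r.+2 by exists (d2 - 2)%N; lia.
(* As $m_2 = n$, once the isolated first vertex is removed the intervals of the two end vertices
   cover the clique of size [a + b]. *)
have ar : (a <= r)%N.
  by move: ffd1; rewrite rE dE; case: ltnP => // _; lia.
have [laws1 laws2] : epos (fun N => tofrac (cl N 1)) /\
    epos (fun N => tofrac (XG N (a + b).+2 [:: r.+1] b)).
  split; last by apply: epos_one_left; lia.
  have := eposM (epos_qfact 1) (epos_e 1); apply: epos_ext => N.
  by rewrite rmorphM rmorph_qfact.
apply: epos_ext (eposM laws1 laws2) => N.
rewrite (chromatic_qsym_clique_path N d_dyck path_eq) d1E rE nE XG_first ?rmorphM //.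
by lia.
Qed.
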